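(* Let $\mathcal{G}$ be a set of generators and $\mathcal{F}$ a set of discriminators on a sample space $X$ satisfying: (A1) for all $\nu_1,\nu_2\in\mathcal{G}$, $\log(\rho_{\nu_1}/\rho_{\nu_2})\in \mathrm{span}\,\mathcal{F}$; (A2) $\mathcal{F}$ is even ($f\in\mathcal{F}\Rightarrow -f\in\mathcal{F}$) and $\|f\|_\infty\le\Delta$ for all $f\in\mathcal{F}$; (A3) $\mathcal{F}=\{f_\theta:\theta\in\Theta\subseteq[-1,1]^p\}$ and $\|f_\theta-f_{\theta'}\|_\infty\le L\|\theta-\theta'\|_2$. Consider a GAN model $g_\alpha$ and a real distribution $\mu$, and let $$\epsilon_{\mathrm{TV}}(m,\delta)=\frac{\sqrt{\Xi_{\mathcal{F},\mathcal{G},\mu}\cdot\tau_{m,\delta}}}{2\sqrt2},\qquad \Xi_{\mathcal{F},\mathcal{G},\mu}=\sup_{\nu\in\mathcal{G}}\|\log(\rho_\mu/\rho_\nu)\|_{\mathcal{F},1},$$ with $\tau_{m,\delta}$ defined in the context. Then for any membership inference attack policy on the GAN, with probability at least $1-\delta$ with respect to the randomness of the training samples, the area under the ROC curve satisfies $$\mathrm{AUC}\le-\tfrac12\,\epsilon_{\mathrm{TV}}(m,\delta)^2+\epsilon_{\mathrm{TV}}(m,\delta)+\tfrac12 .$$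
   Context: $\mathcal{G}$ is a set of probability measures on $X$ (the distributions of the possible generators); $\rho_\nu$ denotes the density of a probability measure $\nu$ on $X$. $\mathcal{F}$ is a set of functions $X\to\mathbb{R}$, and $\|f\|_\infty=\sup_{x\in X}|f(x)|$. $\mathrm{span}\,\mathcal{F}=\{w_0+\sum_{i=1}^N w_if_i: w_i\in\mathbb{R}, f_i\in\mathcal{F}, N\in\mathbb{N}\}$. $\mathcal{F}$-variation norm: $\|h\|_{\mathcal{F},1}=\inf\{\sum_{i=1}^N|w_i| : h=w_0+\sum_{i=1}^N w_if_i,\ N\in\mathbb{N}, w_i\in\mathbb{R}, f_i\in\mathcal{F}\}$. Integral probability metric: $d_{\mathcal{F}}(\mu,\nu)=\sup_{f\in\mathcal{F}}\{\mathbb{E}_{x\sim\mu}[f(x)]-\mathbb{E}_{x\sim\nu}[f(x)]\}$. Error quantity: $\tau_{m,\delta}=2\big(\inf_{\nu\in\mathcal{G}}d_{\mathcal{F}}(\mu,\nu)+\tau_{\mathrm{opt}}+C_\delta/\sqrt{m}\big)$ with $C_\delta=16\sqrt{2\pi}\,pL+2\Delta\sqrt{2\log(1/\delta)}$. Here $m$ is the number of i.i.d. training samples from $\mu$, and $\tau_{\mathrm{opt}}$ is an upper bound on the optimization error: $d_{\mathcal{F}}(\hat\mu_m,g_\alpha)-\inf_{\nu\in\mathcal{G}}d_{\mathcal{F}}(\hat\mu_m,\nu)\le\tau_{\mathrm{opt}}$, with $\hat\mu_m$ the empirical distribution of the training samples and $g_\alpha\in\mathcal{G}$ the trained generator with parameters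 $\alpha$. Membership inference setting: the generator parameters are assumed to have distribution $\mathbb{P}(\alpha\mid x_1,\dots,x_m)\propto e^{-\sum_{i=1}^m\ell(\alpha,x_i)}$ given the training samples $x_1,\dots,x_m$ (i.i.d. from $\mu$), with loss $\ell(\alpha,x)=\log(\rho_\mu(x)/\rho_{g_\alpha}(x))$. The attacker knows the generated distribution $g_\alpha$ exactly but not $\alpha$, and is given a single test sample $x\in X$, drawn either from the training set or from $\mu$; it must decide which. In this model the posterior distribution of training samples given $\alpha$ is taken to be $g_\alpha$, so the attack is a hypothesis test of $g_\alpha$ (positive) against $\mu$ (negative). The true (false) positive rate is the probability of declaring ''training sample'' when $x\sim g_\alpha$ (respectively $x\sim\mu$). The ROC curve of an attack policy maps false positive rate to true positive rate, and AUC is the area under it.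
   Formalization: Assumes in addition that Ξ is finite (otherwise ε_TV is undefined) and that ε_TV(m,δ) ≤ 1 (for ε_TV > 1+√2 the stated bound on the AUC is negative, hence false). *)

(* Defs.v *)
From HB Require Import structures.
From mathcomp Require Import all_boot all_order all_algebra.
From mathcomp Require Import all_classical all_reals all_analysis.
Set Implicit Arguments.
Unset Strict Implicit.
Unset Printing Implicit Defensive.
Import Order.TTheory GRing.Theory Num.Theory.
Import numFieldNormedType.Exports.
Local Open Scope classical_set_scope.
Local Open Scope ring_scope.

Definition l2norm (R : realType) (p : nat) (t : 'rV[R]_p) : R :=
  Num.sqrt (\sum_(i < p) t ord0 i ^+ 2).

Definition supnorm (R : realType) (T : Type) (h : T -> R) : \bar R :=
  ereal_sup [set (`|h x|)%:E | x in [set: T]].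

Definition is_density (R : realType) (d : measure_display)
    (T : measurableType d) (lambda : {measure set T -> \bar R})
    (nu : probability T R) (r : T -> R) : Prop :=
  [/\ measurable_fun setT r, (forall x, 0 <= r x) &
      forall B, measurable B -> nu B = (\int[lambda]_(x in B) (r x)%:E)%E].

Definition log_ratio (R : realType) (T : Type) (r1 r2 : T -> R) : T -> R :=
  fun x => ln (r1 x / r2 x).

Definition combination (R : realType) (T : Type) (F : set (T -> R))
    (h : T -> R) (N : nat) (w0 : R) (w : 'I_N -> R) (f : 'I_N -> T -> R)
    : Prop :=
  (forall i, F (f i)) /\ h = (fun x => w0 + \sum_(i < N) w i * f i x).

Definition disc_span (R : realType) (T : Type) (F : set (T -> R))
    : set (T -> R) :=
  [set h | exists N w0 (w : 'I_N -> R) (f : 'I_N -> T -> R),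
     combination F h w0 w f].

(* The infimum of the empty set is +oo, so the norm of a function outside
   disc_span F is +oo. *)
Definition variation_norm (R : realType) (T : Type) (F : set (T -> R))
    (h : T -> R) : \bar R :=
  ereal_inf [set r | exists N w0 (w : 'I_N -> R) (f : 'I_N -> T -> R),
    combination F h w0 w f /\ r = (\sum_(i < N) `|w i|)%:E].

Definition ipm (R : realType) (d : measure_display) (T : measurableType d)
    (F : set (T -> R)) (mu nu : {measure set T -> \bar R}) : \bar R :=
  ereal_sup
    [set (\int[mu]_x (f x)%:E - \int[nu]_x (f x)%:E)%E | f in F].

Section empirical_measure.
Context (R : realType) (d : measure_display) (T : measurableType d) (m : nat).
Variable z : m.-tuple T.

Definition empirical (A : set T) : \bar R :=
  ((m%:R^-1)%:E * \sum_(i < m) \d_(tnth z i) A)%E.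

Let empirical0 : empirical set0 = 0%E.
Proof. by rewrite /empirical big1 ?mule0. Qed.

Let empirical_ge0 A : (0 <= empirical A)%E.
Proof.
by apply: mule_ge0; [rewrite lee_fin invr_ge0|apply: sume_ge0].
Qed.

Let empirical_sigma_additive : semi_sigma_additive empirical.
Proof.
pose mm (k : nat) : {measure set T -> \bar R} :=
  if insub k is Some i then \d_(tnth z i) else mzero.
have c0 : 0 <= (m%:R^-1 : R) by rewrite invr_ge0.
suff -> : empirical = mscale (NngNum c0) (msum mm m).
  exact: measure_semi_sigma_additive.
apply/funext => A; rewrite /empirical /mscale /msum/=; congr (_ * _)%E.
by apply: eq_bigr => i _; rewrite /mm valK.
Qed.

HB.instance Definition _ := isMeasure.Build _ _ _ empirical
  empirical0 empirical_ge0 empirical_sigma_additive.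

End empirical_measure.

Section training.
Context (R : realType) (dO dX dA : measure_display)
  (Omega : measurableType dO) (X : measurableType dX) (A : measurableType dA).

Definition sample (m : nat) (x : 'I_m -> {mfun Omega >-> X}) (w : Omega)
    : m.-tuple X :=
  [tuple x i w | i < m].

(* Taking some of the B i equal to setT gives the product rule for every
   subfamily. *)
Definition iid (P : probability Omega R) (mu : probability X R) (m : nat)
    (x : 'I_m -> {mfun Omega >-> X}) : Prop :=
  (forall i B, measurable B -> P (x i @^-1` B) = mu B) /\
  (forall B : 'I_m -> set X, (forall i, measurable (B i)) ->
    P [set w | forall i, B i (x i w)] =
    (\prod_(i < m) P (x i @^-1` B i))%E).

(* exp(- \sum_i l(a, z_i)) for the loss l(a, x) = log(rho_mu x / rho_{g_a} x),
   with rmu = rho_mu and rg = rho_{g_a} *)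
Definition gibbs_weight (rmu rg : X -> R) (m : nat) (z : m.-tuple X) : R :=
  expR (- \sum_(i < m) log_ratio rmu rg (tnth z i)).

(* The conditional law of alpha given the training samples has, with respect
   to the reference measure kappa on the parameter space, a density
   proportional to the Gibbs weight; the identity integrates this conditional
   law over the events of the sigma-algebra generated by the samples. *)
Definition gibbs_posterior (P : probability Omega R)
    (kappa : {measure set A -> \bar R}) (rmu : X -> R) (rg : A -> X -> R)
    (m : nat) (x : 'I_m -> {mfun Omega >-> X}) (alpha : {mfun Omega >-> A})
    : Prop :=
  let mass (B : set A) (z : m.-tuple X) :=
    (\int[kappa]_(a in B) (gibbs_weight rmu (rg a) z)%:E)%E in
  {ae P, forall w, (0 < mass setT (sample x w) < +oo)%E} /\
  forall (B : set A) (D : set (m.-tuple X)), measurable B -> measurable D ->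
    P ((sample x @^-1` D) `&` (alpha @^-1` B)) =
    (\int[P]_(w in sample x @^-1` D)
       (mass B (sample x w) / mass setT (sample x w)))%E.

End training.

Section attack.
Context (R : realType) (d : measure_display) (X : measurableType d).

(* The attacker sees the generated distribution and the test sample, and
   outputs a possibly randomized real score: the kernel k = A nu gives the
   law of the score of each test sample.  "Training sample" is declared when
   the score exceeds a threshold. *)
Definition attack_policy := probability X R -> R.-pker X ~> R.

(* Probability, for a test sample drawn from nu, of declaring "training
   sample" at the operating point (t, u): above the threshold t always, at a
   score equal to t with probability u. Randomizing at ties joins consecutive
   points of the ROC curve by segments. *)
Definition positive_rate (nu : probability X R) (k : R.-pker X ~> R)
    (t : \bar R) (u : R) : \bar R :=
  (\int[nu]_x (k x [set s : R | t < s%:E] +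
               u%:E * k x [set s : R | s%:E = t]))%E.

(* The ROC curve at false positive rate a, for the test of g (positive)
   against mu (negative). Where the curve is vertical its upper end is taken;
   this concerns countably many a only. *)
Definition roc (g mu : probability X R) (k : R.-pker X ~> R) (a : R)
    : \bar R :=
  ereal_sup [set r | exists t u, [/\ 0 <= u <= 1,
    positive_rate mu k t u = a%:E & r = positive_rate g k t u]].

Definition auc (g mu : probability X R) (k : R.-pker X ~> R) : \bar R :=
  (\int[lebesgue_measure]_(a in `[0%R, 1%R]) roc g mu k a)%E.

End attack.

Section error_terms.
Context (R : realType) (d : measure_display) (X : measurableType d).

Definition C_const (p : nat) (L Delta delta : R) : R :=
  16 * Num.sqrt (2 * pi) * p%:R * L
  + 2 * Delta * Num.sqrt (2 * ln (1 / delta)).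

(* For F nonempty and uniformly bounded and G nonempty, the infimum is
   finite. *)
Definition tau (F : set (X -> R)) (G : set (probability X R))
    (mu : probability X R) (p m : nat) (L Delta tau_opt delta : R) : R :=
  2 * (fine (ereal_inf [set ipm F mu nu | nu in G]) + tau_opt
       + C_const p L Delta delta / Num.sqrt m%:R).

Definition Xi (F : set (X -> R)) (G : set (probability X R))
    (mu : probability X R) (rho : probability X R -> X -> R) : \bar R :=
  ereal_sup
    [set variation_norm F (log_ratio (rho mu) (rho nu)) | nu in G].

(* Meaningful only when Xi is finite. *)
Definition eps_TV (F : set (X -> R)) (G : set (probability X R))
    (mu : probability X R) (rho : probability X R -> X -> R)
    (p m : nat) (L Delta tau_opt delta : R) : R :=
  Num.sqrt (fine (Xi F G mu rho) * tau F G mu p m L Delta tau_opt delta)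
  / (2 * Num.sqrt 2).

End error_terms.

(* Main.v *)
(* By the triangle inequality and the evenness of F, with
   D = sup_F (E_empirical - E_mu), the trained generator satisfies
   d_F(mu, g) <= inf_G d_F(mu, .) + tau_opt + 2 D.  McDiarmid's inequality
   (Hoeffding's lemma and induction on the number of samples) bounds D by its
   mean plus Delta * sqrt (2 log (1 / delta) / m), and dyadic chaining over the
   parameter cube bounds the mean by 9 * sqrt 2 * p * L / sqrt m; no
   symmetrisation is needed.  Since log (rho_mu / rho_g) is a combination of
   discriminators, its integral against mu - g, the symmetrised KL divergence,
   is at most Xi * d_F(mu, g), and it dominates 4 TV^2.  Hence TV <= eps, so
   the ROC curve lies below min (1, a + eps), whose integral is the bound. *)
Require Import Defs.
From HB Require Import structures.
From mathcomp Require Import all_boot all_order all_algebra.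
From mathcomp Require Import ring lra.
From mathcomp Require Import all_classical all_reals all_analysis.
From mathcomp Require Import measurable_realfun.
Set Implicit Arguments.
Unset Strict Implicit.
Unset Printing Implicit Defensive.
Import Order.TTheory GRing.Theory Num.Theory.
Import numFieldNormedType.Exports.
Local Open Scope classical_set_scope.
Local Open Scope ring_scope.

(** * Hoeffding's lemma *)

(** The trained generator depends on the samples, so a concentration bound for one fixed generator
    says nothing about it. The event is therefore defined by the samples alone and controls all
    discriminators at once. A supremum over the discriminators need not be measurable, so
    concentration is applied only to maxima over finite nets, and the distance to the net is added
    pointwise. Origin of [9 * sqrt 2]: level [k] has at most [exp (k p)] points and scale
    [sigma / 2^k], where [sigma = 3 L sqrt p]. Passing from level [k] to [k + 1] costs
    [(k + 2) / 2^k] in units of [p sigma / sqrt (2 p m)]. These costs sum to 6, and [6 p sigma /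
    sqrt (2 p m) = 9 sqrt 2 p L / sqrt m]. *)

Lemma ge0_is_derive_ge (R : realType) (k dk : R -> R) :
  (forall x : R, is_derive x 1 k (dk x)) -> (forall x : R, 0 <= x -> 0 <= dk x) ->
  forall u : R, 0 <= u -> k 0 <= k u.
Proof.
move=> kd dk0 u u0.
apply: (@ger0_derive1_ndecry _ k 0) => //.
- move=> x; rewrite in_itv/= andbT => /ltW x0.
  by rewrite derive1E (let: DeriveDef _ e := kd x in e) dk0.
- apply: continuous_subspaceT => x.
  apply/differentiable_continuous/derivable1_diffP.
  by case: (kd x).
Qed.

(** The difference [k] of the logarithms vanishes at 0, and so does its derivative [v]. The
    derivative of [v] is nonnegative because [4 a b e^x <= (a + b e^x)^2]. In [v], the quotient
    [b e^x / (a + b e^x)] is written as [1 - a / (a + b e^x)]. *)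
Lemma hoeffding_bernoulli (R : realType) (a b u : R) :
  0 <= a -> 0 <= b -> a + b = 1 -> 0 <= u ->
  a + b * expR u <= expR (b * u + u ^+ 2 / 8).
Proof.
move=> a0 b0 ab1 u0.
have D0 x : 0 < a + b * expR x.
  have := expR_gt0 x; move: (expR x) => y y0.
  have [be|bn0] := eqVneq b 0; first by rewrite be mul0r; lra.
  by rewrite ltr_wpDl// mulr_gt0// lt_def bn0 b0.
pose v x := b + x / 4 - 1 + a * (a + b * expR x)^-1.
pose dv x := 4^-1 - a * (b * expR x) * (a + b * expR x) ^- 2.
have vd (x : R) : is_derive x 1 v (dv x).
  have Dn0 := lt0r_neq0 (D0 x).
  have hD : is_derive x 1 (fun x : R => a + b * expR x) (b * expR x).
    by apply: is_derive_eq; rewrite add0r mul1r.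
  have hV := @is_deriveV R (fun x : R => a + b * expR x) x _ 1 Dn0 hD.
  apply: is_derive_eq.
  rewrite /dv /GRing.scale/=.
  by field.
have v0 (x : R) : 0 <= x -> 0 <= v x.
  move=> x0; have -> : 0 = v 0.
    by rewrite /v expR0 mul0r mulr1 ab1 invr1 mulr1; lra.
  apply: (@ge0_is_derive_ge _ v dv vd) => // y _.
  rewrite /dv subr_ge0 ler_pdivrMr ?exprn_gt0//.
  move: (expR y) => e.
  have := sqr_ge0 (a - b * e). rewrite !expr2; lra.
pose k x := b * x + x ^+ 2 / 8 - ln (a + b * expR x).
have kd (x : R) : is_derive x 1 k (v x).
  have Dn0 := lt0r_neq0 (D0 x).
  have hD : is_derive x 1 (fun x : R => a + b * expR x) (b * expR x).
    by apply: is_derive_eq; rewrite add0r mul1r.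
  have hL := @is_derive1_comp R (@ln R) (fun x : R => a + b * expR x) x _ _
    (is_derive1_ln (D0 x)) hD.
  apply: is_derive_eq.
  rewrite /v /GRing.scale/=.
  by field.
have := ge0_is_derive_ge kd v0 u0.
rewrite {1}/k expR0 mulr1 ab1 ln1 mulr0 expr0n mul0r subr0 addr0 subr_ge0.
by rewrite -ler_expR lnK ?posrE.
Qed.

(** This class is closed under every operation used below, including partial integration, and is
    integrable for every probability. Real-valued integrals can thus be manipulated without
    integrability side conditions. *)
Definition bounded_mfun (R : realType) d (T : measurableType d) (f : T -> R) :=
  measurable_fun setT f /\ exists M : R, forall x, `|f x| <= M.

Section bounded_mfun_theory.
Context (R : realType) d (T : measurableType d).
Implicit Types (f g : T -> R) (P : probability T R).

Lemma bounded_mfun_cst (c : R) : bounded_mfun (fun _ : T => c).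
Proof. by split; [exact: measurable_cst|exists `|c|]. Qed.

Lemma bounded_mfunD f g : bounded_mfun f -> bounded_mfun g ->
  bounded_mfun (fun x => f x + g x).
Proof.
move=> [mf [M fM]] [mg [N gN]]; split; first exact: measurable_funD.
by exists (M + N) => x; rewrite (le_trans (ler_normD _ _))// lerD.
Qed.

Lemma bounded_mfunM f g : bounded_mfun f -> bounded_mfun g ->
  bounded_mfun (fun x => f x * g x).
Proof.
move=> [mf [M fM]] [mg [N gN]]; split; first exact: measurable_funM.
by exists (M * N) => x; rewrite normrM ler_pM.
Qed.

Lemma bounded_mfunZ (c : R) f : bounded_mfun f ->
  bounded_mfun (fun x => c * f x).
Proof. by apply: bounded_mfunM; exact: bounded_mfun_cst. Qed.

Lemma bounded_mfunN f : bounded_mfun f -> bounded_mfun (fun x => - f x).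
Proof.
move=> /(bounded_mfunZ (-1)); congr bounded_mfun.
by apply/funext => x; rewrite mulN1r.
Qed.

Lemma bounded_mfunB f g : bounded_mfun f -> bounded_mfun g ->
  bounded_mfun (fun x => f x - g x).
Proof. by move=> bf /bounded_mfunN; exact: bounded_mfunD. Qed.

Lemma bounded_mfun_sum (I : Type) (s : seq I) (f : I -> T -> R) :
  (forall i, bounded_mfun (f i)) -> bounded_mfun (fun x => \sum_(i <- s) f i x).
Proof.
move=> bf; elim: s => [|i s IH].
  by under eq_fun do rewrite big_nil; exact: bounded_mfun_cst.
by under eq_fun do rewrite big_cons; exact: bounded_mfunD.
Qed.

Lemma bounded_mfun_expR f : bounded_mfun f ->
  bounded_mfun (fun x => expR (f x)).
Proof.
move=> [mf [M fM]]; split; first exact: measurableT_comp.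
exists (expR M) => x; rewrite ger0_norm ?expR_ge0// ler_expR.
by rewrite (le_trans (ler_norm _)).
Qed.

Lemma bounded_mfun_maxr f g : bounded_mfun f -> bounded_mfun g ->
  bounded_mfun (fun x => Num.max (f x) (g x)).
Proof.
move=> [mf [M fM]] [mg [N gN]]; split; first exact: measurable_maxr.
exists (M + N) => x.
have M0 := le_trans (normr_ge0 _) (fM x).
have N0 := le_trans (normr_ge0 _) (gN x).
by rewrite maxEle; case: ifP => _;
  [rewrite (le_trans (gN x))// lerDr|rewrite (le_trans (fM x))// lerDl].
Qed.

Lemma bounded_mfun_comp d' (T' : measurableType d') f (h : T' -> T) :
  measurable_fun setT h -> bounded_mfun f -> bounded_mfun (f \o h).
Proof.
move=> mh [mf [M fM]]; split; first exact: measurableT_comp.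
by exists M => x; exact: fM.
Qed.

Lemma bounded_mfun_integrable P f : bounded_mfun f ->
  P.-integrable setT (EFin \o f).
Proof.
move=> [mf [M fM]]; apply: measurable_bounded_integrable => //.
  by rewrite [X in (X < _)%E]probability_setT ltry.
exists M; split; first exact: num_real.
by move=> y My x _; exact: le_trans (fM x) (ltW My).
Qed.

Lemma bounded_mfun_Rint P f : bounded_mfun f ->
  (\int[P]_x (f x)%:E)%E = (\int[P]_x f x)%:E.
Proof.
by move=> bf; rewrite fineK//; apply: integrable_fin_num => //;
  exact: bounded_mfun_integrable.
Qed.

Lemma Rint_cst P (c : R) : \int[P]_x c = c.
Proof. by rewrite Rintegral_cst// [X in fine X]probability_setT mulr1. Qed.

Lemma RintD P f g : bounded_mfun f -> bounded_mfun g ->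
  \int[P]_x (f x + g x) = \int[P]_x f x + \int[P]_x g x.
Proof. by move=> bf bg; rewrite RintegralD//; exact: bounded_mfun_integrable. Qed.

Lemma RintB P f g : bounded_mfun f -> bounded_mfun g ->
  \int[P]_x (f x - g x) = \int[P]_x f x - \int[P]_x g x.
Proof. by move=> bf bg; rewrite RintegralB//; exact: bounded_mfun_integrable. Qed.

Lemma RintZ P (c : R) f : bounded_mfun f ->
  \int[P]_x (c * f x) = c * \int[P]_x f x.
Proof. by move=> bf; rewrite RintegralZl//; exact: bounded_mfun_integrable. Qed.

Lemma RintN P f : bounded_mfun f -> \int[P]_x (- f x) = - \int[P]_x f x.
Proof. by move=> bf; under eq_Rintegral do rewrite -mulN1r; rewrite RintZ// mulN1r. Qed.

Lemma Rint_sum P (I : Type) (s : seq I) (f : I -> T -> R) :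
  (forall i, bounded_mfun (f i)) ->
  \int[P]_x (\sum_(i <- s) f i x) = \sum_(i <- s) \int[P]_x f i x.
Proof.
move=> bf; elim: s => [|i s IH].
  by under eq_Rintegral do rewrite big_nil; rewrite Rint_cst big_nil.
under eq_Rintegral do rewrite big_cons.
by rewrite RintD ?IH ?big_cons//; exact: bounded_mfun_sum.
Qed.

Lemma le_Rint P f g : bounded_mfun f -> bounded_mfun g ->
  (forall x, f x <= g x) -> \int[P]_x f x <= \int[P]_x g x.
Proof.
by move=> bf bg fg; apply: le_Rintegral => //; exact: bounded_mfun_integrable.
Qed.

Lemma Rint_le_cst P f (c : R) : bounded_mfun f ->
  (forall x, f x <= c) -> \int[P]_x f x <= c.
Proof.
by move=> bf fc; rewrite -[leRHS](Rint_cst P); apply: le_Rint => //;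
  exact: bounded_mfun_cst.
Qed.

Lemma Rint_ge_cst P f (c : R) : bounded_mfun f ->
  (forall x, c <= f x) -> c <= \int[P]_x f x.
Proof.
by move=> bf fc; rewrite -[leLHS](Rint_cst P); apply: le_Rint => //;
  exact: bounded_mfun_cst.
Qed.

Lemma eq_Rint_measure P (Q : {measure set T -> \bar R}) f :
  (forall A, measurable A -> P A = Q A) ->
  \int[P]_x f x = \int[Q]_x f x.
Proof.
by move=> PQ; rewrite /Rintegral (eq_measure_integral Q)// => A mA _; exact: PQ.
Qed.

End bounded_mfun_theory.

Lemma Rint_distribution (R : realType) d d' (T : measurableType d)
    (T' : measurableType d') (P : probability T R) (h : {mfun T >-> T'})
    (f : T' -> R) :
  bounded_mfun f -> \int[distribution P h]_y f y = \int[P]_x f (h x).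
Proof.
move=> bf; rewrite /Rintegral integral_pushforward//.
  by apply/measurable_EFinP; case: bf.
by apply: (@bounded_mfun_integrable _ _ _ P (f \o h)); exact: bounded_mfun_comp.
Qed.

Lemma probability_inhabited (R : realType) d (T : measurableType d)
  (P : probability T R) : exists x : T, True.
Proof.
apply: contrapT => nT.
have : P setT = 0%E.
  by rewrite -[RHS](measure0 P); congr (P _); apply/seteqP; split => // x;
    case: nT; exists x.
by rewrite probability_setT => /eqP; rewrite onee_eq0.
Qed.

(** The tangent to [expR] at [z] lies below the graph. Averaging it over [x] and [y] cancels the
    linear part, since [z] is their mean. *)
Lemma expR_convex_comb (R : realType) (t x y : R) : 0 <= t <= 1 ->
  expR ((1 - t) * x + t * y) <= (1 - t) * expR x + t * expR y.
Proof.
move=> /andP[t0 t1]; set z := _ + _.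
have tangent w : expR z * (1 + (w - z)) <= expR w.
  by rewrite (_ : expR w = expR z * expR (w - z)) ?ler_pM2l ?expR_gt0 ?expR_ge1Dx// -expRD subrKC.
have -> : expR z = (1 - t) * (expR z * (1 + (x - z))) + t * (expR z * (1 + (y - z))).
  by rewrite [in X in _ = X]/z; set e := expR _; ring.
by rewrite lerD// ler_wpM2l// subr_ge0.
Qed.

(** By convexity [f] can be replaced by a two-point variable with the same mean on the ends of an
    interval of length [c], which is the case of [hoeffding_bernoulli]. The hypothesis bounds the
    oscillation and not the position of the interval, because in [mcdiarmid] the interval moves with
    the other coordinates. *)
Lemma hoeffding_lemma (R : realType) d (T : measurableType d)
    (P : probability T R) (f : T -> R) (c l : R) :
  bounded_mfun f -> (forall x y, f x - f y <= c) -> 0 <= l ->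
  \int[P]_x expR (l * (f x - \int[P]_x f x)) <= expR (l ^+ 2 * c ^+ 2 / 8).
Proof.
move=> bf fc l0; set e := \int[P]_x f x.
have [x0 _] := probability_inhabited P.
have c0 : 0 <= c by rewrite -(subrr (f x0)).
have [M fM] := bf.2.
pose lo := inf (range f).
have fhi x : f x <= lo + c.
  rewrite -lerBlDr; apply: lb_le_inf; first by exists (f x0); exists x0.
  by move=> _ [y _ <-]; rewrite lerBlDr -lerBlDl.
have flo x : lo <= f x.
  apply: ge_inf; last by exists x.
  exists (- M) => _ [y _ <-].
  by have := fM y; rewrite ler_norml => /andP[].
have elo : lo <= e by exact: Rint_ge_cst.
have ehi : e <= lo + c by exact: Rint_le_cst.
have [cz|cn0] := eqVneq c 0.
  have fe x : f x - e = 0.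
    by have := fhi x; have := flo x; rewrite cz addr0 in ehi *; lra.
  under eq_Rintegral do rewrite fe mulr0.
  by rewrite Rint_cst cz expr0n/= mulr0 mul0r.
have cp : 0 < c by rewrite lt_def cn0.
pose t x := (f x - lo) / c.
pose b := (e - lo) / c.
have b01 : 0 <= b <= 1.
  by rewrite divr_ge0 ?subr_ge0//= ler_pdivrMr// mul1r lerBlDl.
have bt : bounded_mfun t.
  rewrite /t; under eq_fun do rewrite mulrC.
  apply: bounded_mfunZ; apply: bounded_mfunB => //; exact: bounded_mfun_cst.
have It : \int[P]_x t x = b.
  rewrite /t; under eq_Rintegral do rewrite mulrC.
  rewrite RintZ; last by apply: bounded_mfunB => //; exact: bounded_mfun_cst.
  by rewrite RintB ?Rint_cst -?/e 1?mulrC//; exact: bounded_mfun_cst.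
pose A := expR (l * (lo - e)); pose B := expR (l * (lo + c - e)).
have bE : bounded_mfun (fun x => expR (l * (f x - e))).
  by apply: bounded_mfun_expR; apply: bounded_mfunZ; apply: bounded_mfunB => //;
    exact: bounded_mfun_cst.
have bG : bounded_mfun (fun x => A + (B - A) * t x).
  by apply: bounded_mfunD; [exact: bounded_mfun_cst|exact: bounded_mfunZ].
apply: (@le_trans _ _ (\int[P]_x (A + (B - A) * t x))).
  apply: le_Rint => // x.
  have -> : l * (f x - e) = (1 - t x) * (l * (lo - e)) + t x * (l * (lo + c - e)).
    by rewrite /t; field.
  have -> : A + (B - A) * t x = (1 - t x) * A + t x * B by ring.
  apply: expR_convex_comb.
  rewrite divr_ge0 ?subr_ge0//= ler_pdivrMr// mul1r lerBlDl//.
rewrite RintD; [|exact: bounded_mfun_cst|exact: bounded_mfunZ].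
rewrite Rint_cst RintZ// It.
(* The factor taken out is cancelled by the linear term [b * (l * c)] of the Bernoulli bound. *)
have -> : A + (B - A) * b = expR (- (b * (l * c))) * ((1 - b) + b * expR (l * c)).
  rewrite mulrDr [X in _ = _ + X]mulrCA -expRD.
  have -> : - (b * (l * c)) = l * (lo - e) by rewrite /b; field.
  have -> : l * (lo - e) + l * c = l * (lo + c - e) by ring.
  by rewrite -/A -/B; ring.
have h : 1 - b + b * expR (l * c) <= expR (b * (l * c) + (l * c) ^+ 2 / 8).
  case/andP: b01 => b0 b1.
  by apply: hoeffding_bernoulli; [rewrite subr_ge0|exact: b0|exact: subrK|exact: mulr_ge0].
apply: (le_trans (ler_wpM2l (expR_ge0 _) h)).
by rewrite -expRD ler_expR exprMn addKr mulrA.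
Qed.

(** * Product laws on tuples and McDiarmid's inequality *)

Section product_law.
Context (R : realType) d (X : measurableType d).

Definition tuple_cons n (xt : X * n.-tuple X) : n.+1.-tuple X :=
  [the n.+1.-tuple X of xt.1 :: xt.2].

Definition tuple_behead n (t : n.+1.-tuple X) : n.-tuple X :=
  [tuple of behead t].

Lemma measurable_tuple_cons n : measurable_fun setT (@tuple_cons n).
Proof. exact: measurable_cons. Qed.

HB.instance Definition _ n :=
  isMeasurableFun.Build _ _ _ _ _ (@measurable_tuple_cons n).

HB.instance Definition _ n :=
  isMeasurableFun.Build _ _ _ _ (@tuple_behead n) (@measurable_behead _ X n).

Definition box n (B : 'I_n -> set X) : set (n.-tuple X) :=
  [set t | forall i, B i (tnth t i)].

Lemma measurable_box n (B : 'I_n -> set X) :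
  (forall i, measurable (B i)) -> measurable (box B).
Proof.
move=> mB.
have -> : box B = \bigcap_(i in [set: 'I_n]) ((@tnth n X ^~ i) @^-1` B i).
  by apply/seteqP; split => t /= Bt i => [_|]; exact: Bt.
apply: fin_bigcap_measurable; first exact: finite_finset.
by move=> i _; rewrite -[_ @^-1` _]setTI; exact: measurable_tnth.
Qed.

(** The preimage of a set under one coordinate is a box with [setT] elsewhere. Unlike these
    preimages, boxes are closed under intersection, as uniqueness of measures requires. *)
Lemma measurable_tuple_box n : (@measurable _ (n.-tuple X)) =
  <<s [set A | exists B : 'I_n -> set X,
        (forall i, measurable (B i)) /\ A = box B] >>.
Proof.
apply/seteqP; split.
  apply: smallest_sub; first exact: smallest_sigma_algebra.
  move=> A; rewrite -bigcup_seq => -[i _ [C mC <-]].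
  apply: sub_sigma_algebra.
  exists (fun j => if j == i then C else setT); split.
    by move=> j; case: ifP.
  apply/seteqP; split => [t [_ /= Ct] j|t /= Ct].
    by case: ifP => // /eqP ->.
  by split=> //; have := Ct i; rewrite eqxx.
apply: smallest_sub; first exact: sigma_algebra_measurable.
by move=> _ [B [mB ->]]; exact: measurable_box.
Qed.

(** A characterisation by boxes, not a construction: the law of an i.i.d. sample satisfies it
    directly, and [product_law_unique] shows that it determines the measure. *)
Definition product_law (mu : probability X R) n (Q : probability (n.-tuple X) R) :=
  forall B : 'I_n -> set X, (forall i, measurable (B i)) ->
    Q (box B) = (\prod_(i < n) mu (B i))%E.

Variable mu : probability X R.

Lemma product_law_unique n (Q Q' : probability (n.-tuple X) R) :
  product_law mu Q -> product_law mu Q' ->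
  forall A, measurable A -> Q A = Q' A.
Proof.
move=> hQ hQ' A mA.
apply: (measure_unique _ (fun=> setT) (@measurable_tuple_box n)) => //.
- move=> _ _ [B [mB ->]] [C [mC ->]].
  exists (fun i => B i `&` C i); split.
    by move=> i; exact: measurableI.
  by apply/seteqP; split => [t [Bt Ct] i|t BCt]; split => //= i; have [] := BCt i.
- move=> _; exists (fun=> setT); split => //.
  by apply/seteqP; split.
- by rewrite bigcup_const//; exists 0%N.
- move=> _ [B [mB ->]].
  by transitivity (\prod_(i < n) mu (B i))%E; [exact: hQ|exact/esym/hQ'].
- by move=> _; rewrite [X in (X < _)%E]probability_setT ltry.
Qed.

Lemma product_law_behead n (Q : probability (n.+1.-tuple X) R) :
  product_law mu Q -> product_law mu (distribution Q (@tuple_behead n)).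
Proof.
move=> hQ B mB.
pose B' i := if unlift ord0 i is Some j then B j else setT.
have tnthE (t : n.+1.-tuple X) j : tnth t (lift ord0 j) = tnth (tuple_behead t) j.
  by rewrite [in LHS](tuple_eta t) tnthS.
transitivity (Q (box B')).
  congr (Q _); apply/seteqP; split => t /= Bt i.
    rewrite /B'; case: unliftP => [j ->|//].
    by rewrite tnthE; exact: Bt.
  by have := Bt (lift ord0 i); rewrite /B' liftK tnthE.
rewrite hQ; last by move=> i; rewrite /B'; case: unlift.
rewrite big_ord_recl {1}/B' unlift_none.
rewrite [X in (X * _)%E]probability_setT mul1e.
by apply: eq_bigr => i _; rewrite /B' liftK.
Qed.

Lemma product_law_cons n (Q : probability (n.-tuple X) R) :
  product_law mu Q -> product_law mu (distribution (mu \x Q)%E (@tuple_cons n)).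
Proof.
move=> hQ B mB; rewrite big_ord_recl.
transitivity ((mu \x Q)%E (B ord0 `*` box (fun i => B (lift ord0 i)))).
  congr ((mu \x Q)%E _); apply/seteqP; split => -[x t] /= Bt.
    split; first by have := Bt ord0.
    by move=> i; have := Bt (lift ord0 i); rewrite tnthS.
  move=> i; case: (unliftP ord0 i) => [j ->|->]; rewrite ?tnthS; last exact: Bt.1.
  exact: Bt.2.
rewrite product_measure1E; [|exact: mB|by apply: measurable_box => i; exact: mB].
by congr (_ * _)%E; apply: hQ => i; exact: mB.
Qed.

Lemma bounded_mfun_Rint1 d' (Y : measurableType d') (Q : probability Y R)
    (f : X * Y -> R) :
  bounded_mfun f -> bounded_mfun (fun y => \int[mu]_x f (x, y)).
Proof.
move=> bf.
have bfy y : bounded_mfun (fun x => f (x, y)).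
  have := @bounded_mfun_comp _ _ _ _ X f (fun x => (x, y)) _ bf.
  by apply; exact: measurable_fun_pair.
split.
  (* Measurability of the partial integral is taken from Fubini's theorem for [mu \x Q]. *)
  have mF : measurable_fun setT (fubini_G mu (EFin \o f)).
    apply: (@measurable_fubini_G _ _ _ _ _ mu Q).
    exact: bounded_mfun_integrable (mu \x Q)%E _ bf.
  by apply: (measurableT_comp _ mF).
have [M fM] := bf.2; exists M => y.
rewrite ler_norml; apply/andP; split.
  by apply: Rint_ge_cst => // x; have := fM (x, y); rewrite ler_norml => /andP[].
by apply: Rint_le_cst => // x; have := fM (x, y); rewrite ler_norml => /andP[].
Qed.

Lemma Rint_fubini d' (Y : measurableType d') (Q : probability Y R)
    (f : X * Y -> R) : bounded_mfun f ->
  \int[(mu \x Q)%E]_z f z = \int[Q]_y \int[mu]_x f (x, y).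
Proof.
move=> bf; rewrite {1}/Rintegral -integral21_prod_meas1; last first.
  exact: bounded_mfun_integrable (mu \x Q)%E _ bf.
rewrite /fubini_G; congr fine; apply: eq_integral => y _ /=.
rewrite bounded_mfun_Rint//.
have := @bounded_mfun_comp _ _ _ _ X f (fun x => (x, y)) _ bf.
by apply; exact: measurable_fun_pair.
Qed.

(** Splits off the first coordinate, for the induction in [mcdiarmid]: by uniqueness [Q] is the
    image of [mu \x Q'] under [tuple_cons], and Fubini applies. *)
Lemma Rint_product_law n (Q : probability (n.+1.-tuple X) R)
    (f : n.+1.-tuple X -> R) : product_law mu Q -> bounded_mfun f ->
  \int[Q]_t f t =
  \int[distribution Q (@tuple_behead n)]_t \int[mu]_x f (tuple_cons (x, t)).
Proof.
move=> hQ bf; set Q' := distribution _ _.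
have hQ' : product_law mu Q' by exact: product_law_behead.
rewrite (eq_Rint_measure f (product_law_unique hQ (product_law_cons hQ'))).
rewrite Rint_distribution//.
rewrite (Rint_fubini _ (f := f \o (@tuple_cons n)))//.
by apply: bounded_mfun_comp => //; exact: measurable_tuple_cons.
Qed.

Lemma Rint_product_law_tnth n (Q : probability (n.-tuple X) R) (h : X -> R)
    (i : 'I_n) : product_law mu Q -> bounded_mfun h ->
  \int[Q]_t h (tnth t i) = \int[mu]_x h x.
Proof.
move=> hQ bh.
pose T := MeasurableFun.Pack (MeasurableFun.Class
  (isMeasurableFun.Build _ _ _ _ _ (measurable_tnth i))) : {mfun n.-tuple X >-> X}.
rewrite -(Rint_distribution Q T bh).
apply: eq_Rint_measure => A mA.
have := hQ (fun j => if j == i then A else setT).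
rewrite (bigD1 i)//= eqxx big1 ?mule1 => [<-|j /negbTE ->]; last 2 first.
- by move=> j; case: ifP.
- by rewrite probability_setT.
congr (Q _); apply/seteqP; split => [t /= At j|t /= At].
  by case: ifP => // /eqP ->.
by have := At i; rewrite eqxx.
Qed.

(** Let [g] be [f] averaged over the first coordinate. Then [exp (l (f - e))] factors into
    [exp (l (f - g))], bounded by Hoeffding's lemma for each fixed tail, and [exp (l (g - e))],
    bounded by induction. *)
Lemma mcdiarmid n (Q : probability (n.-tuple X) R) (f : n.-tuple X -> R)
    (c l : R) :
  product_law mu Q -> bounded_mfun f ->
  (forall i s t, (forall j, j != i -> tnth s j = tnth t j) -> f s - f t <= c) ->
  0 <= l ->
  \int[Q]_t expR (l * (f t - \int[Q]_t f t)) <=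
  expR (l ^+ 2 * (n%:R * c ^+ 2) / 8).
Proof.
move=> + + + l0; elim: n Q f => [|n IH] Q f hQ bf fc.
  have fe t : f t = f [tuple] by congr f; exact: tuple0.
  have -> : \int[Q]_t f t = f [tuple].
    by under eq_Rintegral do rewrite fe; rewrite Rint_cst.
  under eq_Rintegral do rewrite fe subrr mulr0.
  by rewrite Rint_cst mul0r mulr0 mul0r.
have bexp e : bounded_mfun (fun t => expR (l * (f t - e))).
  apply: bounded_mfun_expR; apply: bounded_mfunZ; apply: bounded_mfunB => //.
  exact: bounded_mfun_cst.
rewrite (Rint_product_law hQ (bexp _)) (Rint_product_law hQ bf).
set Q' := distribution _ _.
have hQ' : product_law mu Q' by exact: product_law_behead.
pose g t := \int[mu]_x f (tuple_cons (x, t)).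
have bc (h : n.+1.-tuple X -> R) : bounded_mfun h -> bounded_mfun (h \o @tuple_cons n).
  by move=> bh; apply: bounded_mfun_comp => //; exact: measurable_tuple_cons.
have bct (h : n.+1.-tuple X -> R) (t : n.-tuple X) :
    bounded_mfun h -> bounded_mfun (fun x => h (tuple_cons (x, t))).
  move=> bh.
  have mp : measurable_fun [set: X] (fun x : X => (x, t)).
    exact: measurable_fun_pair.
  exact: (bounded_mfun_comp mp (bc h bh)).
have bg : bounded_mfun g by exact: (bounded_mfun_Rint1 Q' (bc f bf)).
rewrite -/(g _) -/g.
set e := \int[Q']_t g t.
(* Averaging preserves bounded differences; coordinate [i] of the tail is coordinate [lift ord0 i]
   of the full tuple. *)
have gc i s t : (forall j, j != i -> tnth s j = tnth t j) -> g s - g t <= c.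
  move=> st; rewrite -RintB; [|exact: bct..].
  apply: Rint_le_cst => [|x]; first by apply: bounded_mfunB; exact: bct.
  apply: (fc (lift ord0 i)) => j.
  case: (unliftP ord0 j) => [k ->|-> _//]; rewrite !tnthS => ki.
  by apply: st; apply: contra ki => /eqP ->.
apply: (@le_trans _ _
    (\int[Q']_t (expR (l ^+ 2 * c ^+ 2 / 8) * expR (l * (g t - e))))).
  apply: le_Rint => [||t].
  - exact: (bounded_mfun_Rint1 Q' (bc _ (bexp e))).
  - apply: bounded_mfunZ; apply: bounded_mfun_expR; apply: bounded_mfunZ.
    by apply: bounded_mfunB => //; exact: bounded_mfun_cst.
  have -> : \int[mu]_x expR (l * (f (tuple_cons (x, t)) - e)) =
      expR (l * (g t - e)) * \int[mu]_x expR (l * (f (tuple_cons (x, t)) - g t)).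
    rewrite -RintZ; last exact: (bct (fun s => expR (l * (f s - g t)))).
    by apply: eq_Rintegral => x _; rewrite -expRD; congr expR; ring.
  rewrite mulrC ler_wpM2r ?expR_ge0//.
  apply: hoeffding_lemma => //; first exact: bct.
  move=> x y; apply: (fc ord0) => j.
  by case: (unliftP ord0 j) => [k ->|->]; rewrite ?eqxx// !tnthS.
rewrite RintZ; last first.
  apply: bounded_mfun_expR; apply: bounded_mfunZ.
  by apply: bounded_mfunB => //; exact: bounded_mfun_cst.
rewrite (le_trans (ler_wpM2l (expR_ge0 _) (IH Q' g hQ' bg gc)))//.
rewrite -expRD ler_expR -natr1; lra.
Qed.

End product_law.

(** * Deviations of empirical means *)

Section empirical_mean.
Context (R : realType) d (X : measurableType d).
Variables (mu : probability X R) (m : nat) (Q : probability (m.-tuple X) R).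
Hypotheses (m_gt0 : (0 < m)%N) (hQ : product_law mu Q).

Definition deviation (h : X -> R) (t : m.-tuple X) : R :=
  m%:R^-1 * (\sum_(i < m) h (tnth t i)) - \int[mu]_x h x.

Lemma bounded_mfun_deviation (h : X -> R) :
  bounded_mfun h -> bounded_mfun (deviation h).
Proof.
move=> bh; apply: bounded_mfunB; last exact: bounded_mfun_cst.
apply: bounded_mfunZ; apply: bounded_mfun_sum => i.
exact: (bounded_mfun_comp (measurable_tnth i) bh).
Qed.

Lemma deviationB (g h : X -> R) t : bounded_mfun g -> bounded_mfun h ->
  deviation (fun x => g x - h x) t = deviation g t - deviation h t.
Proof.
by move=> bg bh; rewrite /deviation sumrB RintB//; ring.
Qed.

Lemma deviation_le (h : X -> R) t c : bounded_mfun h ->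
  (forall x, `|h x| <= c) -> deviation h t <= 2 * c.
Proof.
move=> bh hc; have hcc x : - c <= h x /\ h x <= c.
  by have := hc x; rewrite ler_norml => /andP[].
have m0 : 0 < m%:R :> R by rewrite ltr0n.
have sle : m%:R^-1 * (\sum_(i < m) h (tnth t i)) <= c.
  rewrite ler_pdivrMl//; apply: (@le_trans _ _ (\sum_(i < m) c)).
    by apply: ler_sum => i _; exact: (hcc _).2.
  by rewrite sumr_const card_ord mulr_natl.
have := @Rint_ge_cst _ _ _ mu h (- c) bh (fun x => (hcc x).1).
by rewrite /deviation; lra.
Qed.

Lemma deviation_bounded_difference (h : X -> R) c :
  (forall x y, h x - h y <= c) ->
  forall i s t, (forall j, j != i -> tnth s j = tnth t j) ->
  deviation h s - deviation h t <= c / m%:R.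
Proof.
move=> hc i s t st; rewrite /deviation.
rewrite [leLHS](_ : _ =
    m%:R^-1 * (\sum_(i < m) h (tnth s i) - \sum_(i < m) h (tnth t i))); last by ring.
rewrite -sumrB (bigD1 i)//= big1 ?addr0 => [|j ji]; last by rewrite st// subrr.
by rewrite mulrC ler_wpM2r// invr_ge0.
Qed.

Lemma Rint_deviation (h : X -> R) : bounded_mfun h ->
  \int[Q]_t deviation h t = 0.
Proof.
move=> bh.
have bi i : bounded_mfun (fun t : m.-tuple X => h (tnth t i)).
  exact: (bounded_mfun_comp (measurable_tnth i) bh).
rewrite RintB; [|by apply: bounded_mfunZ; exact: bounded_mfun_sum|
                 exact: bounded_mfun_cst].
rewrite Rint_cst RintZ; last exact: bounded_mfun_sum.
rewrite Rint_sum//; under eq_bigr do rewrite (Rint_product_law_tnth _ hQ bh).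
rewrite sumr_const card_ord -[X in _^-1 * X]mulr_natl mulKf ?subrr//.
by rewrite pnatr_eq0 -lt0n.
Qed.

(** Changing one sample moves the deviation by at most [2 s / m], and
    [m (2 s / m)^2 / 8 = s^2 / (2 m)]. *)
Lemma subgaussian_deviation (h : X -> R) (s l : R) : bounded_mfun h ->
  (forall x, `|h x| <= s) -> 0 <= l ->
  \int[Q]_t expR (l * deviation h t) <= expR (l ^+ 2 * s ^+ 2 / (2 * m%:R)).
Proof.
move=> bh hs l0.
have m0 : m%:R != 0 :> R by rewrite pnatr_eq0 -lt0n.
have hc x y : h x - h y <= 2 * s.
  have := hs x; have := hs y; rewrite !ler_norml => /andP[? ?] /andP[? ?]; lra.
have := mcdiarmid hQ (bounded_mfun_deviation bh)
  (deviation_bounded_difference hc) l0.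
rewrite Rint_deviation//; under eq_Rintegral do rewrite subr0.
move/le_trans; apply; rewrite ler_expR le_eqVlt; apply/orP; left; apply/eqP.
by field.
Qed.

(* [y <= a - 1 + exp (y - a)] replaces the maximum of the deviations by a
   finite sum, which is integrated termwise. *)
Lemma maximal_inequality (I : finType) (h : I -> X -> R) (s l N : R) :
  (forall i, bounded_mfun (h i)) -> (forall i x, `|h i x| <= s) ->
  0 < l -> #|I|%:R <= expR N ->
  exists W, [/\ bounded_mfun W, (forall i t, deviation (h i) t <= W t) &
    \int[Q]_t W t <= (N + l ^+ 2 * s ^+ 2 / (2 * m%:R)) / l].
Proof.
move=> bh hs l0 IN; set a := N + _.
have bS : bounded_mfun (fun t => \sum_i expR (l * deviation (h i) t)).
  apply: bounded_mfun_sum => i; apply: bounded_mfun_expR; apply: bounded_mfunZ.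
  exact: bounded_mfun_deviation.
exists (fun t => l^-1 * (a - 1 + expR (- a) * \sum_i expR (l * deviation (h i) t))).
split.
- apply: bounded_mfunZ; apply: bounded_mfunD; first exact: bounded_mfun_cst.
  exact: bounded_mfunZ.
- move=> i t; rewrite -ler_pdivrMl ?invr_gt0// invrK.
  have := expR_ge1Dx (l * deviation (h i) t - a).
  rewrite expRD [X in _ <= X]mulrC => h1.
  have h2 : expR (- a) * expR (l * deviation (h i) t) <=
      expR (- a) * \sum_i expR (l * deviation (h i) t).
    rewrite ler_wpM2l ?expR_ge0// (bigD1 i)//= lerDl.
    by apply: sumr_ge0 => j _; exact: expR_ge0.
  lra.
- rewrite RintZ; last first.
    by apply: bounded_mfunD; [exact: bounded_mfun_cst|exact: bounded_mfunZ].
  rewrite RintD; [|exact: bounded_mfun_cst|exact: bounded_mfunZ].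
  rewrite Rint_cst RintZ// Rint_sum; last first.
    move=> i; apply: bounded_mfun_expR; apply: bounded_mfunZ.
    exact: bounded_mfun_deviation.
  rewrite mulrC ler_wpM2r ?invr_ge0 ?(ltW l0)//.
  (* By the choice of [a], the sum of exponentials has mean at most [exp a]: [exp N] bounds the
     number of terms and the rest of [a] bounds each term. The exponential part is thus at most 1
     and cancels the [- 1]. *)
  rewrite -[leRHS](subrK 1 a) lerD2l.
  rewrite mulrC expRN ler_pdivrMr ?expR_gt0// mul1r expRD.
  apply: (@le_trans _ _ (\sum_(i : I) expR (l ^+ 2 * s ^+ 2 / (2 * m%:R)))).
    by apply: ler_sum => i _; apply: subgaussian_deviation => //; exact: ltW.
  by rewrite sumr_const -[_ *+ _]mulr_natl ler_wpM2r ?expR_ge0.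
Qed.

Lemma mcdiarmid_tail (f : m.-tuple X -> R) (c e v : R) : bounded_mfun f ->
  (forall i s t, (forall j, j != i -> tnth s j = tnth t j) -> f s - f t <= c) ->
  0 < c -> 0 <= v -> \int[Q]_t f t <= e ->
  ((1 - expR (- (2 * v ^+ 2 / (m%:R * c ^+ 2))))%:E <=
    Q [set t | (f t <= e + v)%R])%E.
Proof.
move=> bf fc c0 v0 fe.
have m0 : 0 < m%:R :> R by rewrite ltr0n.
set E := [set t | _].
have mE : measurable E.
  rewrite (_ : E = f @^-1` [set` `]-oo, e + v]]).
    by rewrite -[X in measurable X]setTI; apply: bf.1.
  by apply/seteqP; split => t /=; rewrite in_itv.
(* The minimiser of [l^2 m c^2 / 8 - l v], the exponent in Chernoff's bound. *)
pose l := 4 * v / (m%:R * c ^+ 2).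
have l0 : 0 <= l by rewrite divr_ge0 ?mulr_ge0// ?ltW.
have bexp : bounded_mfun (fun t => expR (l * (f t - \int[Q]_t f t))).
  apply: bounded_mfun_expR; apply: bounded_mfunZ.
  by apply: bounded_mfunB => //; exact: bounded_mfun_cst.
have b1 : bounded_mfun (\1_(~` E) : m.-tuple X -> R).
  split; first by apply: measurable_indic; exact: measurableC.
  by exists 1 => t; rewrite indicE; case: (_ \in _); rewrite ?normr1 ?normr0.
have QC : Q (~` E) = (\int[Q]_t \1_(~` E) t)%:E.
  rewrite -bounded_mfun_Rint// integral_indic ?setIT//; exact: measurableC.
have : Q (~` E) = (1 - Q E)%E by rewrite probability_setC.
have QEfin : Q E \is a fin_num by exact: fin_num_measure.
rewrite QC -(fineK QEfin) -EFinB => -[QE].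
rewrite lee_fin lerBlDr -lerBlDl -QE.
apply: (@le_trans _ _ (expR (- (l * v)) *
    \int[Q]_t expR (l * (f t - \int[Q]_t f t)))).
  (* Outside [E], [f] exceeds its mean by more than [v], so the exponential dominates the indicator
     there. *)
  rewrite -RintZ//; apply: le_Rint => //; first exact: bounded_mfunZ.
  move=> t; rewrite -expRD indicE; case: (boolP (t \in _)) => [|_]; last exact: expR_ge0.
  rewrite inE /E /= => /negP; rewrite -ltNge => tE.
  rewrite -[leLHS]expR0 ler_expR -mulrN -mulrDr mulr_ge0//; lra.
apply: (le_trans (ler_wpM2l (expR_ge0 _) (mcdiarmid hQ bf fc l0))).
rewrite -expRD ler_expR le_eqVlt; apply/orP; left; apply/eqP; rewrite /l.
by field; rewrite ?lt0r_neq0.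
Qed.

End empirical_mean.

(** * Dyadic chaining and nets of the parameter set *)

Section chaining.
Context (R : realType) d (X : measurableType d).
Variables (mu : probability X R) (m : nat) (Q : probability (m.-tuple X) R).
Hypotheses (m_gt0 : (0 < m)%N) (hQ : product_law mu Q).
Variables (S : Type) (h : S -> X -> R) (p : nat) (sigma : R).
Hypotheses (p_gt0 : (0 < p)%N) (sigma_gt0 : 0 < sigma).
Hypothesis bh : forall s, bounded_mfun (h s).

(** The cardinality is bounded by an exponential because [maximal_inequality] takes its logarithm;
    at level 0 it leaves at most one point. Approximation is uniform in [x], hence valid for every
    sample. *)
Definition net (k : nat) (I : finType) (q : I -> S) (pi : S -> I) : Prop :=
  #|I|%:R <= expR (k%:R * p%:R) :> R /\
  forall s x, `|h s x - h (q (pi s)) x| <= sigma / 2 ^+ k.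

Hypothesis nets : forall k, exists (I : finType) (q : I -> S) (pi : S -> I),
  net k q pi.
Variable s0 : S.

Let a : R := Num.sqrt (2 * p%:R * m%:R).

Let a_gt0 : 0 < a.
Proof. by rewrite sqrtr_gt0 !mulr_gt0// ltr0n. Qed.

(* A net point is projected onto the next coarser net one level at a time, so
   the nets need not be nested. *)
Lemma chaining k : exists (I : finType) (q : I -> S) (pi : S -> I) W,
  [/\ net k q pi, bounded_mfun W,
    (forall c t, deviation mu (h (q c)) t <= W t) &
    \int[Q]_t W t <= p%:R * sigma / a * (6 - (k%:R * 2 + 6) / 2 ^+ k)].
Proof.
elim: k => [|k [I [q [pi [W [nk bW devW IW]]]]]].
  have [I [q [pi n0]]] := nets 0.
  (* The level-0 net has a single point, whose deviation has mean 0; this is the claimed bound at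
     [k = 0]. *)
  exists I, q, pi, (deviation mu (h (q (pi s0)))); split => //.
  - exact: bounded_mfun_deviation.
  - move=> c t; have c1 : (#|I| <= 1)%N by move: n0.1; rewrite mul0r expR0 -(ler_nat R).
    by rewrite (card_le1_eqP c1 c (pi s0)).
  - rewrite Rint_deviation// le_eqVlt; apply/orP; left; apply/eqP.
    by rewrite mul0r add0r expr0 divr1 subrr mulr0.
have [J [r [rho nJ]]] := nets k.+1.
pose Y c x := h (r c) x - h (q (pi (r c))) x.
have bY c : bounded_mfun (Y c) by exact: bounded_mfunB.
have Ys c x : `|Y c x| <= sigma / 2 ^+ k by exact: nk.2.
(* This makes the variance term of [maximal_inequality] equal to [p], so the step costs
   [((k + 1) p + p) / l]. *)
pose l := a * 2 ^+ k / sigma.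
have l0 : 0 < l by rewrite divr_gt0// mulr_gt0// exprn_gt0.
have [V [bV devV IV]] := maximal_inequality m_gt0 hQ bY Ys l0 nJ.1.
exists J, r, rho, (fun t => W t + V t); split => //.
- exact: bounded_mfunD.
- move=> c t; apply: le_trans (lerD (devW (pi (r c)) t) (devV c t)).
  by rewrite deviationB// addrC subrK.
- rewrite RintD//; apply: (le_trans (lerD IW IV)).
  (* The bound is the closed form of the partial sums of [(j + 2) / 2^j] over [j < k], whose limit
     is 6. *)
  rewrite le_eqVlt; apply/orP; left; apply/eqP.
  have a2 : a ^+ 2 = 2 * p%:R * m%:R by rewrite sqr_sqrtr// !mulr_ge0.
  have l2 : l ^+ 2 * (sigma / 2 ^+ k) ^+ 2 / (2 * m%:R) = p%:R.
    have -> : l ^+ 2 * (sigma / 2 ^+ k) ^+ 2 = a ^+ 2.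
      by rewrite /l; field; rewrite ?lt0r_neq0 ?exprn_gt0.
    by rewrite a2; field; rewrite pnatr_eq0 -lt0n.
  rewrite l2 /l exprS -natr1; field.
  by rewrite !lt0r_neq0// exprn_gt0.
Qed.

Lemma uniform_deviation (k : nat) (Delta v : R) :
  (forall s x, `|h s x| <= Delta) -> 0 < Delta -> 0 <= v ->
  exists E : set (m.-tuple X), [/\ measurable E,
    ((1 - expR (- (m%:R * v ^+ 2 / (2 * Delta ^+ 2))))%:E <= Q E)%E &
    forall t s, E t ->
      deviation mu (h s) t <= 6 * p%:R * sigma / a + v + 2 * (sigma / 2 ^+ k)].
Proof.
move=> hD D0 v0.
have m0 : 0 < m%:R :> R by rewrite ltr0n.
have [I [q [pi [W [nk bW devW IW]]]]] := chaining k.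
(* [W] bounds the mean, but nothing is known about its differences. The maximum [M] lies below [W]
   and has differences at most [2 Delta / m]. The starting value of the maximum is itself a
   deviation at a net point, so both properties survive. *)
pose M (t : m.-tuple X) := \big[Num.max/deviation mu (h (q (pi s0))) t]_(c : I)
  deviation mu (h (q c)) t.
have bM : bounded_mfun M.
  rewrite /M; elim: (index_enum I) => [|c s IH].
    under eq_fun do rewrite big_nil; exact: bounded_mfun_deviation.
  under eq_fun do rewrite big_cons.
  by apply: bounded_mfun_maxr => //; exact: bounded_mfun_deviation.
have hc s x y : h s x - h s y <= 2 * Delta.
  have := hD s x; have := hD s y.
  by rewrite !ler_norml => /andP[? ?] /andP[? ?]; lra.
have Mc i s t : (forall j, j != i -> tnth s j = tnth t j) ->
    M s - M t <= 2 * Delta / m%:R.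
  move=> st; rewrite lerBlDr; apply: bigmax_le => [|c _].
    apply: (@le_trans _ _ (2 * Delta / m%:R + deviation mu (h (q (pi s0))) t)).
      by rewrite -lerBlDr; apply: deviation_bounded_difference st.
    by rewrite lerD2l bigmax_ge_id.
  apply: (@le_trans _ _ (2 * Delta / m%:R + deviation mu (h (q c)) t)).
    by rewrite -lerBlDr; apply: deviation_bounded_difference st.
  by rewrite lerD2l; exact: le_bigmax.
have IM : \int[Q]_t M t <= 6 * p%:R * sigma / a.
  apply: (@le_trans _ _ (\int[Q]_t W t)).
    by apply: le_Rint => // t; apply: bigmax_le.
  apply: (le_trans IW).
  rewrite mulrBr lerBlDr [leLHS](_ : _ = 6 * p%:R * sigma / a); last by ring.
  rewrite lerDl; apply: mulr_ge0; apply: divr_ge0; last exact: exprn_ge0.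
  - exact: mulr_ge0 (ler0n _ _) (ltW sigma_gt0).
  - exact: ltW.
  - by rewrite addr_ge0 ?mulr_ge0.
have c0 : 0 < 2 * Delta / m%:R by rewrite divr_gt0// mulr_gt0.
exists [set t | M t <= 6 * p%:R * sigma / a + v]; split.
- rewrite (_ : mkset _ = M @^-1` [set` `]-oo, 6 * p%:R * sigma / a + v]]).
    by rewrite -[X in measurable X]setTI; apply: bM.1.
  by apply/seteqP; split => t /=; rewrite in_itv.
- apply: le_trans (mcdiarmid_tail m_gt0 hQ bM Mc c0 v0 IM).
  rewrite lee_fin lerD2l lerN2 ler_expR lerN2 le_eqVlt.
  by apply/orP; left; apply/eqP; field; rewrite !lt0r_neq0.
- move=> t s /= tE.
  have -> : deviation mu (h s) t = deviation mu (h (q (pi s))) t +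
      deviation mu (fun x => h s x - h (q (pi s)) x) t.
    by rewrite deviationB// addrC subrK.
  apply: lerD; last by apply: deviation_le => //; [exact: bounded_mfunB|exact: nk.2].
  by apply: le_trans tE; exact: (le_bigmax _ (fun c => deviation mu (h (q c)) t)).
Qed.

End chaining.

(** The cube is cut into [2^k] cells per axis, and [2^(k p) <= exp (k p)]. Each occupied cell is
    represented by one of its points in [Theta], since the Lipschitz bound holds only there; two
    points of a cell differ by at most [3 / 2^k] in each coordinate. *)
Lemma box_net (R : realType) (p k : nat) (Theta : set 'rV[R]_p)
    (t0 : {t | Theta t}) :
  (forall t, Theta t -> forall i, -1 <= t ord0 i <= 1) ->
  exists (I : finType) (q : I -> {t | Theta t}) (pi : {t | Theta t} -> I),
    #|I|%:R <= expR (k%:R * p%:R) :> R /\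
    forall s, l2norm (sval s - sval (q (pi s))) <= 3 * Num.sqrt p%:R / 2 ^+ k.
Proof.
move=> box; pose n := (2 ^ k).-1.
have nE : n.+1 = (2 ^ k)%N by rewrite prednK// expn_gt0.
have k0 : 0 < 2 ^+ k :> R by rewrite exprn_gt0.
(* Coordinates range over an interval of length 2. Dividing by 3 keeps [u] strictly below [2^k] even
   at the right end, so its truncation is a valid cell index. *)
pose u (s : {t | Theta t}) i : R := (sval s ord0 i + 1) / 3 * 2 ^+ k.
have u0 s i : 0 <= u s i.
  have /andP[? ?] := box _ (svalP s) i.
  by rewrite mulr_ge0 ?exprn_ge0// divr_ge0//; lra.
have un s i : (Num.truncn (u s i) < n.+1)%N.
  rewrite -(ltr_nat R) nE natrX.
  apply: (@le_lt_trans _ _ (u s i)); first by rewrite truncn_le.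
  rewrite -[ltRHS]mul1r ltr_pM2r//.
  have /andP[? ?] := box _ (svalP s) i.
  lra.
pose pi s : {ffun 'I_p -> 'I_n.+1} := [ffun i => Ordinal (un s i)].
(* Cells that miss [Theta] get the default [t0]; they are never of the form [pi s]. *)
pose q c := if pselect (exists s, pi s = c) is left e then sval (cid e) else t0.
have piq s : pi (q (pi s)) = pi s.
  rewrite /q; case: pselect => [e|[]]; last by exists s.
  by case: cid.
exists {ffun 'I_p -> 'I_n.+1}, q, pi; split.
  rewrite card_ffun !card_ord nE -expnM natrX.
  rewrite -natrM -[X in expR X]mulr1 expRM_natl.
  by rewrite lerXn2r ?nnegrE ?expR_ge0//; have := expR_ge1Dx (1 : R).
move=> s; set s' := q (pi s).
have close i : (sval s ord0 i - sval s' ord0 i) ^+ 2 <= (3 / 2 ^+ k) ^+ 2.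
  have : Num.truncn (u s i) = Num.truncn (u s' i).
    by have /ffunP/(_ i) := piq s; rewrite !ffunE => -[].
  have /andP[a1 a2] := truncn_itv (u0 s i).
  have /andP[b1 b2] := truncn_itv (u0 s' i).
  move=> e; rewrite e -natr1 in a1 a2; rewrite -natr1 in b2.
  have : `|u s i - u s' i| <= 1 by rewrite ler_norml; apply/andP; split; lra.
  rewrite [X in `|X|](_ : _ =
    (sval s ord0 i - sval s' ord0 i) / (3 / 2 ^+ k)); last first.
    by rewrite /u; field; rewrite lt0r_neq0.
  have z0 : 0 < 3 / 2 ^+ k :> R by rewrite divr_gt0.
  rewrite normrM [`|(3 / _)^-1|]gtr0_norm ?invr_gt0// ler_pdivrMr// mul1r => h.
  by rewrite -real_normK ?num_real// lerXn2r ?nnegrE// ltW.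
rewrite /l2norm.
have -> : 3 * Num.sqrt p%:R / 2 ^+ k = Num.sqrt (p%:R * (3 / 2 ^+ k) ^+ 2) :> R.
  by rewrite sqrtrM// sqrtr_sqr gtr0_norm ?divr_gt0//; ring.
apply: ler_wsqrtr.
apply: (@le_trans _ _ (\sum_(i < p) (3 / 2 ^+ k) ^+ 2)).
  by apply: ler_sum => i _; rewrite !mxE.
by rewrite sumr_const card_ord [leRHS]mulr_natl.
Qed.

(** * Total variation and the symmetrised KL divergence *)

Section density.
Context (R : realType) d (X : measurableType d)
  (lambda : {measure set X -> \bar R}).

Import HBNNSimple.

(** For simple functions this is the definition of a density on level sets; monotone convergence on
    both sides gives the general case. *)
Lemma ge0_integral_density (nu : probability X R) (r u : X -> R) :
  is_density lambda nu r -> measurable_fun setT u -> (forall x, 0 <= u x) ->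
  (\int[nu]_x (u x)%:E = \int[lambda]_x (u x * r x)%:E)%E.
Proof.
move=> [mr r0 nuE] mu u0.
have mEu : measurable_fun setT (EFin \o u) by exact/measurable_EFinP.
pose h := nnsfun_approx measurableT mEu.
have hu x : (h n x)%:E @[n --> \oo] --> (u x)%:E.
  by apply: cvg_nnsfun_approx => // y _; rewrite lee_fin.
have simple (s : {nnsfun X >-> R}) :
    (\int[nu]_x (s x)%:E = \int[lambda]_x (s x * r x)%:E)%E.
  rewrite integralT_nnsfun sintegralE.
  have sE x : (s x * r x)%:E = (\sum_(y \in range s)
      y%:E * (\1_(s @^-1` [set y]) x * r x)%:E)%E.
    rewrite EFinM {1}(fimfunE s x) -fsumEFin// ge0_mule_fsuml => [|y].
      by apply: eq_fsbigr => y _; rewrite -!EFinM mulrA.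
    by rewrite EFinM; exact: nnfun_muleindic_ge0.
  under [RHS]eq_integral do rewrite sE.
  rewrite ge0_integral_fsum//; last 2 first.
  - move=> y; apply: measurable_funeM; apply/measurable_EFinP.
    by apply: measurable_funM => //; exact: measurable_indic.
  - move=> y x _; have := nnfun_muleindic_ge0 s y x.
    by rewrite -!EFinM !lee_fin mulrA => ?; exact: mulr_ge0.
  apply: eq_fsbigr => y; rewrite inE => -[z _ <-].
  rewrite ge0_integralZl_EFin//; last first.
  - by apply/measurable_EFinP; apply: measurable_funM => //; exact: measurable_indic.
  - by move=> x _; rewrite lee_fin mulr_ge0.
  congr (_ * _)%E; transitivity (\int[lambda]_(x in s @^-1` [set s z]) (r x)%:E)%E.
    exact: nuE.
  rewrite integral_mkcond; apply: eq_integral => x _.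
  by rewrite patchE indicE; case: ifP => _; rewrite ?mul1r ?mul0r.
transitivity (limn (fun n => \int[nu]_x (h n x)%:E)%E).
  rewrite -monotone_convergence//.
  - by apply: eq_integral => x _; apply/esym/cvg_lim => //; exact: hu.
  - by move=> n; apply/measurable_EFinP.
  - by move=> n x _; rewrite lee_fin.
  - by move=> x _ i j ij; rewrite lee_fin; exact/lefP/nd_nnsfun_approx.
under eq_fun do rewrite simple.
rewrite -monotone_convergence//.
- apply: eq_integral => x _; apply/cvg_lim => //.
  under eq_fun do rewrite EFinM muleC.
  rewrite EFinM muleC; apply: cvgeZl => //; exact: hu.
- by move=> n; apply/measurable_EFinP; exact: measurable_funM.
- by move=> n x _; rewrite lee_fin mulr_ge0.
- move=> x _ i j ij; rewrite lee_fin ler_wpM2r//.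
  exact/lefP/nd_nnsfun_approx.
Qed.

(* Adding a constant to both functions reduces to nonnegative integrands, for
   which the densities can be used without integrability conditions. *)
Lemma le_Rint_density (nu1 nu2 : probability X R) (r1 r2 u1 u2 : X -> R) :
  is_density lambda nu1 r1 -> is_density lambda nu2 r2 ->
  bounded_mfun u1 -> bounded_mfun u2 ->
  (forall x, u1 x * r1 x <= u2 x * r2 x) ->
  \int[nu1]_x u1 x <= \int[nu2]_x u2 x.
Proof.
move=> d1 d2 b1 b2 le12.
have [_ [M1 hM1]] := b1; have [_ [M2 hM2]] := b2.
have [x0 _] := probability_inhabited nu1.
pose M := M1 + M2.
have M1_0 := le_trans (normr_ge0 _) (hM1 x0).
have M2_0 := le_trans (normr_ge0 _) (hM2 x0).
have M0 : 0 <= M by exact: addr_ge0.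
have p1 x : 0 <= u1 x + M.
  by have := hM1 x; rewrite ler_norml => /andP[? ?]; rewrite /M; lra.
have p2 x : 0 <= u2 x + M.
  by have := hM2 x; rewrite ler_norml => /andP[? ?]; rewrite /M; lra.
have bc := @bounded_mfun_cst R _ X M.
have [mr1 r1_0 _] := d1; have [mr2 r2_0 _] := d2.
have b1M := bounded_mfunD b1 bc; have b2M := bounded_mfunD b2 bc.
(* The constant integrals are taken against the opposite measures, so that the terms in [M] agree on
   both sides once densities are inserted. *)
have : (\int[nu1]_x (u1 x + M)%:E + \int[nu2]_x M%:E <=
        \int[nu2]_x (u2 x + M)%:E + \int[nu1]_x M%:E)%E.
  rewrite (ge0_integral_density d1 b1M.1)// (ge0_integral_density d2 b2M.1)//.
  rewrite (ge0_integral_density d1 bc.1)// (ge0_integral_density d2 bc.1)//.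
  have mM (u r : X -> R) : measurable_fun setT u -> measurable_fun setT r ->
      measurable_fun setT (fun x => (u x * r x)%:E).
    by move=> ? ?; apply/measurable_EFinP; exact: measurable_funM.
  have m1 := mM _ _ b1M.1 mr1; have m2 := mM _ _ b2M.1 mr2.
  have m3 := mM _ _ bc.1 mr1; have m4 := mM _ _ bc.1 mr2.
  rewrite -!ge0_integralD//; do ?[by move=> x _; rewrite lee_fin mulr_ge0].
  apply: ge0_le_integral => //. 
  - by move=> x ?; rewrite lee_fin addr_ge0// mulr_ge0.
  - by apply: emeasurable_funD.
  - by apply: emeasurable_funD.
  - by move=> x _; rewrite lee_fin; have := le12 x; lra.
rewrite (bounded_mfun_Rint nu1 b1M) (bounded_mfun_Rint nu2 b2M).
rewrite (bounded_mfun_Rint nu1 bc) (bounded_mfun_Rint nu2 bc).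
by rewrite -!EFinD lee_fin (RintD nu1 b1 bc) (RintD nu2 b2 bc) !Rint_cst; lra.
Qed.

End density.

(** The logarithmic mean is at most the arithmetic mean. With [s = ln (x / y) >= 0] this is
    [2 (e^s - 1) <= s (e^s + 1)]; the difference vanishes at 0 and has derivative [1 - e^s + s e^s],
    nonnegative since [1 - s <= e^(-s)]. *)
Lemma log_mean_le (R : realType) (x y : R) : 0 < x -> 0 < y ->
  2 * (x - y) ^+ 2 <= (x + y) * ((x - y) * ln (x / y)).
Proof.
have key (s : R) : 0 <= s -> 0 <= s * (expR s + 1) - 2 * (expR s - 1).
  move=> s0; pose k (s : R) := s * (expR s + 1) - 2 * (expR s - 1).
  pose dk (s : R) := 1 - expR s + s * expR s.
  have kd (z : R) : is_derive z 1 k (dk z).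
    apply: is_derive_eq; rewrite /dk /GRing.scale/=; ring.
  have -> : 0 = k 0 by rewrite /k expR0; ring.
  apply: (ge0_is_derive_ge kd) => // z z0; rewrite /dk.
  have := expR_ge1Dx (- z); rewrite expRN.
  rewrite -(ler_pM2r (expR_gt0 z)) mulVf ?lt0r_neq0 ?expR_gt0//; lra.
wlog xy : x y / y <= x.
  move=> W x0 y0; have [yx|/ltW xy] := leP y x; first exact: W.
  have := W y x xy y0 x0.
  rewrite -[y / x]invf_div lnV ?posrE ?divr_gt0//.
  by rewrite [y + x]addrC (_ : (y - x) ^+ 2 = (x - y) ^+ 2); [lra|ring].
move=> x0 y0.
have s0 : 0 <= ln (x / y) by rewrite ln_ge0// ler_pdivlMr// mul1r.
have := key _ s0; rewrite lnK ?posrE ?divr_gt0//.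
set s := ln _ => h.
have {}h : 0 <= (s * (x + y) - 2 * (x - y)).
  rewrite (_ : _ - _ = y * (s * (x / y + 1) - 2 * (x / y - 1))).
    by rewrite mulr_ge0// ltW.
  by field; rewrite lt0r_neq0.
have := mulr_ge0 (_ : 0 <= x - y) h; rewrite subr_ge0 => /(_ xy).
by rewrite expr2; lra.
Qed.

(* With c the left-hand difference and psi = 2 phi - 1, log_mean_le gives
   c psi (r2 - r1) <= (r1 - r2) ln (r1 / r2) / 4 + c^2 (r1 + r2) / 2 pointwise;
   integrating it replaces Cauchy-Schwarz. *)
Lemma total_variation_le_jeffreys (R : realType) d (X : measurableType d)
    (lambda : {measure set X -> \bar R}) (mu nu : probability X R)
    (r1 r2 phi : X -> R) :
  is_density lambda mu r1 -> is_density lambda nu r2 ->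
  (forall x, 0 < r1 x) -> (forall x, 0 < r2 x) ->
  bounded_mfun (log_ratio r1 r2) ->
  bounded_mfun phi -> (forall x, 0 <= phi x <= 1) ->
  4 * (\int[nu]_x phi x - \int[mu]_x phi x) ^+ 2 <=
  \int[mu]_x log_ratio r1 r2 x - \int[nu]_x log_ratio r1 r2 x.
Proof.
move=> d1 d2 r1_0 r2_0 bh bphi phi01.
set c := _ - \int[mu]_x phi x.
pose u e x := c * (2 * phi x - 1) + log_ratio r1 r2 x / 4 + e.
have bl : bounded_mfun (fun x => c * (2 * phi x - 1)).
  apply: bounded_mfunZ; apply: bounded_mfunB; last exact: bounded_mfun_cst.
  exact: bounded_mfunZ.
have bh4 : bounded_mfun (fun x => log_ratio r1 r2 x / 4).
  by apply: bounded_mfunM => //; exact: bounded_mfun_cst.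
have bu e : bounded_mfun (u e).
  by apply: bounded_mfunD; [exact: bounded_mfunD|exact: bounded_mfun_cst].
have Iu (P : probability X R) e : \int[P]_x u e x =
    c * (2 * \int[P]_x phi x - 1) + (\int[P]_x log_ratio r1 r2 x) / 4 + e.
  rewrite RintD//; [|exact: bounded_mfunD|exact: bounded_mfun_cst].
  rewrite Rint_cst RintD// RintZ; last first.
    apply: bounded_mfunB; last exact: bounded_mfun_cst.
    exact: bounded_mfunZ.
  rewrite RintB; [|exact: bounded_mfunZ|exact: bounded_mfun_cst].
  rewrite RintZ// Rint_cst.
  under [X in _ + X + _]eq_Rintegral do rewrite mulrC.
  by rewrite RintZ// [4^-1 * _]mulrC.
have : \int[nu]_x u (- (c ^+ 2 / 2)) x <= \int[mu]_x u (c ^+ 2 / 2) x.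
  apply: (le_Rint_density d2 d1) => // x.
  rewrite /u; have := log_mean_le (r1_0 x) (r2_0 x); rewrite -/(log_ratio r1 r2 x).
  have := r1_0 x; have := r2_0 x; have /andP[] := phi01 x.
  move: (log_ratio r1 r2 x) (r1 x) (r2 x) (phi x) => H x1 x2 f f0 f1 x2_0 x1_0 HH.
  have s0 : 0 < x1 + x2 by exact: addr_gt0.
  rewrite -subr_ge0 -(pmulr_rge0 _ s0).
  have q : 0 <= (c * (x1 + x2) - (2 * f - 1) * (x2 - x1)) ^+ 2 by exact: sqr_ge0.
  have f2 : (2 * f - 1) ^+ 2 * (x2 - x1) ^+ 2 <= (x2 - x1) ^+ 2.
    rewrite ler_piMl ?sqr_ge0// expr2; nra.
  (* A sum of three nonnegative terms: a square, the slack in [psi^2 <= 1], and the slack in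
     [log_mean_le]. *)
  rewrite (_ : _ * _ = 2^-1 * (c * (x1 + x2) - (2 * f - 1) * (x2 - x1)) ^+ 2
     + 2^-1 * ((x2 - x1) ^+ 2 - (2 * f - 1) ^+ 2 * (x2 - x1) ^+ 2)
     + 4^-1 * ((x1 + x2) * ((x1 - x2) * H) - 2 * (x1 - x2) ^+ 2)); last by field.
  lra.
(* With [J] the symmetrised divergence, the integrated inequality reads [2 c^2 <= J / 4 + c^2]. *)
rewrite !Iu /c; lra.
Qed.

(** * Area under the ROC curve *)

(* Needed without measurability: the ROC curve is only a supremum. *)
Lemma le_integral_pointwise (R : realType) d (T : measurableType d)
    (nu : {measure set T -> \bar R}) (D : set T) (f g : T -> \bar R) :
  (forall x, D x -> (f x <= g x)%E) ->
  (\int[nu]_(x in D) f x <= \int[nu]_(x in D) g x)%E.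
Proof.
move=> fg; have fgD := lee_restrict fg.
(* Positive and negative parts are integrated as suprema over the simple functions below them, which
   are monotone for arbitrary functions. *)
rewrite /integral; apply: leeB; apply: ereal_sup_le => _ [h /= hf <-]; exists h => // x.
  apply: (le_trans (hf x)); rewrite !funeposE ge_max !le_max lexx orbT andbT.
  by rewrite fgD.
apply: (le_trans (hf x)); rewrite !funenegE ge_max !le_max lexx orbT andbT.
by rewrite leeN2 fgD.
Qed.

Section auc_bound.
Context (R : realType).

Lemma integral_min1 (e : R) : 0 <= e <= 1 ->
  (\int[@lebesgue_measure R]_(a in `[0%R, 1%R]) (Num.min 1 (a + e))%:E =
   (- (1 / 2) * e ^+ 2 + e + 1 / 2)%:E)%E.
Proof.
move=> /andP[e0 e1].
(* The integral is split at [c = 1 - e]; for [e = 1] the left piece degenerates and the fundamental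
   theorem of calculus cannot be used. *)
have [->|en1] := eqVneq e 1.
  rewrite (eq_integral (cst 1%:E)) => [|a]; last first.
    by rewrite inE/= in_itv/= => /andP[a0 _]; rewrite min_l// lerDr.
  rewrite integral_cst//= lebesgue_measure_itv/= lte_fin ltr01 -EFinB -EFinM.
  by congr EFin; field.
have e1' : e < 1 by rewrite lt_neqAle en1.
pose c := 1 - e; have c0 : 0 < c by rewrite subr_gt0.
have c1 : c <= 1 by rewrite gerBl.
have mm (D : set R) : measurable D ->
    measurable_fun D (fun a => (Num.min 1 (a + e))%:E).
  move=> mD; apply/measurable_EFinP; apply: measurable_funTS.
  by apply: measurable_minr => //; apply: measurable_funD.
rewrite (@itv_bndbnd_setU _ _ _ (BRight c)) ?bnd_simp ?(ltW c0)//.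
rewrite ge0_integral_setU//=; last 3 first.
- by apply: mm; apply: measurableU.
- move=> a; rewrite !in_itv/= lee_fin le_min ler01/= => a01.
  by rewrite addr_ge0//; case: a01 => /andP[] // /(lt_trans c0)/ltW.
- rewrite disj_set2E; apply/eqP; apply/seteqP; split => // a /=.
  by rewrite !in_itv/= => -[/andP[_ ac] /andP[]]; rewrite ltNge ac.
have -> : (\int[@lebesgue_measure R]_(a in `[0%R, c]) (Num.min 1 (a + e))%:E =
    \int[@lebesgue_measure R]_(a in `[0%R, c]) (a + e)%:E)%E.
  apply: eq_integral => a.
  by rewrite inE/= in_itv/= => /andP[_ ac]; rewrite min_r// -lerBrDr.
rewrite [X in (_ + X)%E](eq_integral (cst 1%:E)) => [|a]; last first.
  rewrite inE/= in_itv/= => /andP[ca _]; rewrite min_l// -lerBlDr.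
  exact: ltW.
rewrite integral_cst//= lebesgue_measure_itv/= lte_fin.
pose F (a : R) := a ^+ 2 / 2 + e * a.
have dF (a : R) : is_derive a 1 F (a + e).
  by apply: is_derive_eq; rewrite /GRing.scale/=; field.
have cF (a : R) : {for a, continuous F}.
  apply: differentiable_continuous; apply/derivable1_diffP.
  by case: (dF a).
rewrite (@continuous_FTC2 _ _ F)//; last 3 first.
- apply: continuous_subspaceT => a; apply: cvgD; [exact: cvg_id|exact: cvg_cst].
- split.
  + by move=> a _; case: (dF a).
  + apply: cvg_at_right_filter; exact: cF.
  + apply: cvg_at_left_filter; exact: cF.
- by move=> a _; rewrite derive1E; case: (dF a).
have -> : (c < 1) = (0 < e) by rewrite /c ltrBlDr ltrDl.
rewrite /F /c; case: ifPn => [_|].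
  by rewrite -!EFinB -EFinM -EFinD; congr EFin; field.
rewrite -leNgt => e0'; have -> : e = 0 by apply/eqP; rewrite eq_le e0 e0'.
by rewrite mule0 adde0 -EFinB; congr EFin; field.
Qed.

Context d (X : measurableType d).

(** An operating point is a randomised test [phi]. The same [phi] serves for every [nu], so true and
    false positive rates can be compared through total variation. *)
Lemma positive_rateE (k : R.-pker X ~> R) (t : \bar R) (u : R) : 0 <= u <= 1 ->
  exists phi, [/\ bounded_mfun phi, forall x : X, 0 <= phi x <= 1 &
    forall nu, positive_rate nu k t u = (\int[nu]_x phi x)%:E].
Proof.
move=> /andP[u0 u1].
have mE : measurable_fun [set: R] (@EFin R) by exact/measurable_EFinP.
pose A := [set s : R | (t < s%:E)%E]; pose B := [set s : R | s%:E = t].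
have mA : measurable A.
  rewrite (_ : A = EFin @^-1` `]t, +oo[%classic).
    by rewrite -[X in measurable X]setTI; apply: mE => //; exact: emeasurable_itv.
  by apply/seteqP; split => s /=; rewrite in_itv/= andbT.
have mB : measurable B.
  rewrite (_ : B = EFin @^-1` [set t]) //.
  by rewrite -[X in measurable X]setTI; apply: mE => //; exact: emeasurable_set1.
have AB x : (k x A + k x B <= 1)%E.
  rewrite -(@prob_kernel _ _ _ _ _ k x) -measureU//.
    by apply: le_measure; rewrite ?inE//; exact: measurableU.
  by apply/seteqP; split => // s [] /[swap]; rewrite /A /B /= => ->; rewrite ltxx.
pose psi x := (k x A + u%:E * k x B)%E.
have psi0 x : (0 <= psi x)%E by rewrite adde_ge0// mule_ge0.
have psi1 x : (psi x <= 1)%E.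
  by apply: le_trans (AB x); rewrite leeD2l// gee_pMl// ?lee_fin//.
have psifin x : psi x \is a fin_num.
  by rewrite ge0_fin_numE// (le_lt_trans (psi1 x))// ltry.
have mpsi : measurable_fun setT psi.
  apply: emeasurable_funD; first exact: measurable_kernel.
  by apply: measurable_funeM; exact: measurable_kernel.
have phi01 x : 0 <= fine (psi x) <= 1.
  by rewrite -!lee_fin fineK// psi0 psi1.
have bphi : bounded_mfun (fine \o psi).
  split; first exact: measurableT_comp.
  by exists 1 => x; have /andP[? ?] := phi01 x; rewrite ger0_norm.
exists (fine \o psi); split => // nu.
rewrite -bounded_mfun_Rint//; apply: eq_integral => x _.
by rewrite fineK.
Qed.

Lemma auc_le (g mu : probability X R) (k : R.-pker X ~> R) (e : R) :
  0 <= e <= 1 ->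
  (forall phi, bounded_mfun phi -> (forall x, 0 <= phi x <= 1) ->
    \int[g]_x phi x - \int[mu]_x phi x <= e) ->
  (auc g mu k <= (- (1 / 2) * e ^+ 2 + e + 1 / 2)%:E)%E.
Proof.
move=> e01 tv; rewrite -integral_min1//; apply: le_integral_pointwise => a _.
apply: ge_ereal_sup => _ [t [u [u01 mua ->]]].
have [phi [bphi phi01 rate]] := positive_rateE k t u01.
move: mua; rewrite !rate => -[<-].
rewrite lee_fin le_min; apply/andP; split.
  by apply: Rint_le_cst => // x; case/andP: (phi01 x).
by rewrite -lerBlDl tv.
Qed.

End auc_bound.

(** * Integral probability metrics *)

Section integral_probability_metric.
Context (R : realType) d (X : measurableType d).
Variables (F : set (X -> R)) (Delta : R).
Hypothesis F_meas : forall h, F h -> measurable_fun setT h.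
Hypothesis F_even : forall h, F h -> F (fun y => - h y).
Hypothesis F_bounded : forall h, F h -> (supnorm h <= Delta%:E)%E.

Lemma supnorm_le (h : X -> R) (c : R) : (supnorm h <= c%:E)%E ->
  forall x, `|h x| <= c.
Proof.
move=> hc x; rewrite -lee_fin; apply: le_trans hc.
by apply: ereal_sup_ubound; exists x.
Qed.

Lemma bounded_mfun_discriminator h : F h -> bounded_mfun h.
Proof.
move=> Fh; split; first exact: F_meas.
by exists Delta; exact: supnorm_le (F_bounded Fh).
Qed.

Lemma integral_empirical m (z : m.-tuple X) (h : X -> R) : bounded_mfun h ->
  (\int[empirical R z]_x (h x)%:E)%E =
  (m%:R^-1 * \sum_(i < m) h (tnth z i))%:E.
Proof.
move=> bh.
have c0 : 0 <= (m%:R^-1 : R) by rewrite invr_ge0.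
(* [msum] takes a sequence of measures, so the Dirac masses are continued by zero beyond [m]. *)
pose mm (k : nat) : {measure set X -> \bar R} :=
  if insub k is Some i then \d_(tnth z i) else mzero.
have empE (A : set X) : empirical R z A = mscale (NngNum c0) (msum mm m) A.
  rewrite /empirical /mscale /msum/=; congr (_ * _)%E.
  by apply: eq_bigr => i _; rewrite /mm valK.
have ge0E (u : X -> \bar R) : measurable_fun setT u -> (forall x, 0 <= u x)%E ->
    (\int[empirical R z]_x u x = m%:R^-1%:E * \sum_(i < m) u (tnth z i))%E.
  move=> mu u0.
  rewrite (eq_measure_integral (mscale (NngNum c0) (msum mm m))); last first.
    by move=> A _ _; exact: empE.
  rewrite ge0_integral_mscale// ge0_integral_measure_sum//; congr (_ * _)%E.
  apply: eq_bigr => i _; rewrite /mm valK.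
  by rewrite integral_dirac// diracT mul1e.
have mh : measurable_fun setT (EFin \o h) by apply/measurable_EFinP; exact: bh.1.
rewrite integralE ge0E//; last exact: measurable_funepos.
rewrite ge0E//; last exact: measurable_funeneg.
have posE x : ((fun x => (h x)%:E)^\+ x = (Num.max (h x) 0)%:E)%E.
  by rewrite funeposE -EFin_max.
have negE x : ((fun x => (h x)%:E)^\- x = (Num.max (- h x) 0)%:E)%E.
  by rewrite funenegE -EFinN -EFin_max.
under eq_bigr do rewrite posE.
under [X in (_ - _ * X)%E]eq_bigr do rewrite negE.
rewrite !sumEFin -!EFinM -EFinB -mulrBr -sumrB; congr EFin; congr (_ * _).
apply: eq_bigr => i _.
by rewrite !maxEle; do 2!case: ifPn; rewrite -?ltNge; lra.
Qed.

Lemma ipm_ge (mu nu : probability X R) h : F h ->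
  ((\int[mu]_x h x - \int[nu]_x h x)%:E <= ipm F mu nu)%E.
Proof.
move=> Fh; apply: ereal_sup_ubound; exists h => //.
have bh := bounded_mfun_discriminator Fh.
by rewrite (bounded_mfun_Rint mu bh) (bounded_mfun_Rint nu bh).
Qed.

Lemma ipm_le (mu nu : probability X R) (c : R) :
  (forall h, F h -> \int[mu]_x h x - \int[nu]_x h x <= c) ->
  (ipm F mu nu <= c%:E)%E.
Proof.
move=> hc; apply: ge_ereal_sup => _ [h Fh <-].
have bh := bounded_mfun_discriminator Fh.
by rewrite (bounded_mfun_Rint mu bh) (bounded_mfun_Rint nu bh) lee_fin hc.
Qed.

Lemma ipm_empirical_ge m (z : m.-tuple X) (nu : probability X R) h : F h ->
  ((m%:R^-1 * (\sum_(i < m) h (tnth z i)) - \int[nu]_x h x)%:E <=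
   ipm F (empirical R z) nu)%E.
Proof.
move=> Fh; apply: ereal_sup_ubound; exists h => //.
have bh := bounded_mfun_discriminator Fh.
by rewrite (bounded_mfun_Rint nu bh) integral_empirical.
Qed.

Lemma ipm_empirical_le m (z : m.-tuple X) (nu : probability X R) (c : R) :
  (forall h, F h ->
    m%:R^-1 * (\sum_(i < m) h (tnth z i)) - \int[nu]_x h x <= c) ->
  (ipm F (empirical R z) nu <= c%:E)%E.
Proof.
move=> hc; apply: ge_ereal_sup => _ [h Fh <-].
have bh := bounded_mfun_discriminator Fh.
by rewrite (bounded_mfun_Rint nu bh) integral_empirical// lee_fin hc.
Qed.

Hypothesis F_neq0 : exists h, F h.

Lemma ipm_fin_num (mu nu : probability X R) : ipm F mu nu \is a fin_num.
Proof.
have [h Fh] := F_neq0.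
rewrite fin_numE; apply/andP; split; apply/eqP => e.
  by have := ipm_ge mu nu Fh; rewrite e leeNy_eq.
have : (ipm F mu nu <= (Delta + Delta)%:E)%E.
  apply: ipm_le => {Fh e}h Fh.
  have bh := bounded_mfun_discriminator Fh.
  have hD x : - Delta <= h x /\ h x <= Delta.
    by have := supnorm_le (F_bounded Fh) x; rewrite ler_norml => /andP[].
  have := Rint_le_cst mu bh (fun x => (hD x).2).
  have := Rint_ge_cst nu bh (fun x => (hD x).1).
  lra.
by rewrite e leye_eq.
Qed.

Lemma ipm_ge0 (mu nu : probability X R) : (0 <= ipm F mu nu)%E.
Proof.
have [h Fh] := F_neq0.
have h1 := ipm_ge mu nu Fh; have h2 := ipm_ge mu nu (F_even Fh).
have bh := bounded_mfun_discriminator Fh.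
move: h2; rewrite -(fineK (ipm_fin_num mu nu)) in h1 *; rewrite !lee_fin in h1 *.
rewrite !RintN//; lra.
Qed.

Lemma ipm_empirical_ge0 m (z : m.-tuple X) (nu : probability X R) :
  (0 <= ipm F (empirical R z) nu)%E.
Proof.
have [h Fh] := F_neq0; have bh := bounded_mfun_discriminator Fh.
have h1 := ipm_empirical_ge z nu Fh.
have := ipm_empirical_ge z nu (F_even Fh); rewrite sumrN mulrN RintN// => h2.
have [x0|x0] := leP 0 (m%:R^-1 * (\sum_(i < m) h (tnth z i)) - \int[nu]_x h x).
  by apply: le_trans h1; rewrite lee_fin.
by apply: le_trans h2; rewrite lee_fin; lra.
Qed.

(** [B] is paid twice: once to compare the empirical and true infima, once to return from the
    empirical measure to [mu] at the trained generator. The second comparison uses the deviation of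
    [- h], so a one-sided bound on the even class suffices. *)
Lemma ipm_generalization (G : set (probability X R)) (mu nu : probability X R)
    m (z : m.-tuple X) (B t : R) :
  G nu -> (forall h, F h -> deviation mu h z <= B) ->
  (ipm F (empirical R z) nu
   - ereal_inf [set ipm F (empirical R z) nu' | nu' in G] <= t%:E)%E ->
  (ipm F mu nu <=
   (fine (ereal_inf [set ipm F mu nu' | nu' in G]) + t + 2 * B)%:E)%E.
Proof.
move=> Gnu dev opt.
set J := ereal_inf _ in opt.
set I := ereal_inf _.
have [h0 Fh0] := F_neq0.
have Ifin : I \is a fin_num.
  rewrite ge0_fin_numE.
    apply: (@le_lt_trans _ _ (ipm F mu nu)).
      by apply: ereal_inf_lbound; exists nu.
    by rewrite ltey_eq ipm_fin_num.
  by apply: le_ereal_inf_tmp => _ [nu' _ <-]; exact: ipm_ge0.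
have JI : (J <= I + B%:E)%E.
  rewrite -leeBlDr//; apply: le_ereal_inf_tmp => _ [nu' Gnu' <-].
  rewrite leeBlDr//; apply: (@le_trans _ _ (ipm F (empirical R z) nu')).
    by apply: ereal_inf_lbound; exists nu'.
  rewrite -(fineK (ipm_fin_num mu nu')) -EFinD; apply: ipm_empirical_le => h Fh.
  have := ipm_ge mu nu' Fh; rewrite -(fineK (ipm_fin_num mu nu')) lee_fin.
  by have := dev h Fh; rewrite /deviation; lra.
have Jlt : (J < +oo)%E.
  by rewrite (le_lt_trans JI)// -(fineK Ifin) -EFinD ltry.
have {}opt : (ipm F (empirical R z) nu <= (t + (fine I + B))%:E)%E.
  have optJ : (ipm F (empirical R z) nu <= t%:E + J)%E.
    (* [opt] subtracts extended reals, so [J] must be finite before it can change sides. *)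
    have Jgt : (-oo < J)%E.
      apply: lt_le_trans (ltNyr 0) _.
      by apply: le_ereal_inf_tmp => _ [nu' _ <-]; exact: ipm_empirical_ge0.
    by rewrite -leeBlDr// fin_numElt Jgt Jlt.
  apply: (le_trans optJ); rewrite EFinD leeD2l// EFinD fineK//.
apply: ipm_le => h Fh.
have bh := bounded_mfun_discriminator Fh.
have := dev _ (F_even Fh); rewrite /deviation RintN// sumrN mulrN.
have := le_trans (ipm_empirical_ge z nu Fh) opt; rewrite lee_fin; lra.
Qed.

(** The constant [w0] cancels between two probabilities, and by evenness each discriminator
    contributes at most [t] in absolute value. The infimum need not be attained, so a nearly optimal
    combination is used; its slack [e / (t + 1)] stays below [e] after multiplication by [t], also
    when [t = 0]. *)
Lemma variation_norm_ipm (mu nu : probability X R) (h : X -> R) (v t : R) :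
  (variation_norm F h <= v%:E)%E -> (ipm F mu nu <= t%:E)%E ->
  \int[mu]_x h x - \int[nu]_x h x <= v * t.
Proof.
move=> hv ht.
have t0 : 0 <= t by rewrite -lee_fin (le_trans (ipm_ge0 mu nu)).
have wt h' : F h' -> `|\int[mu]_x h' x - \int[nu]_x h' x| <= t.
  move=> Fh'; have bh := bounded_mfun_discriminator Fh'.
  have := le_trans (ipm_ge mu nu Fh') ht.
  have := le_trans (ipm_ge mu nu (F_even Fh')) ht.
  by rewrite !lee_fin !RintN// ler_norml => ? ?; apply/andP; split; lra.
apply/ler_addgt0Pr => e e0.
have e1 : 0 < e / (t + 1) by rewrite divr_gt0// ltr_wpDl.
have : (variation_norm F h < (v + e / (t + 1))%:E)%E.
  by rewrite (le_lt_trans hv)// lte_fin ltrDl.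
move=> /ereal_inf_lt[_ [N [w0 [w [f [[Ff ->] ->]]]]]].
rewrite lte_fin => wv.
have bf i : bounded_mfun (f i) by exact: bounded_mfun_discriminator.
have bs : bounded_mfun (fun x => \sum_(i < N) w i * f i x).
  by apply: bounded_mfun_sum => i; exact: bounded_mfunZ.
have E (P : probability X R) : \int[P]_x (w0 + \sum_(i < N) w i * f i x) =
    w0 + \sum_(i < N) w i * \int[P]_x f i x.
  rewrite RintD//; last exact: bounded_mfun_cst.
  rewrite Rint_cst Rint_sum => [|i]; last exact: bounded_mfunZ.
  by congr (_ + _); apply: eq_bigr => i _; rewrite RintZ.
rewrite !E opprD addrACA subrr add0r -sumrB.
apply: (@le_trans _ _ ((\sum_(i < N) `|w i|) * t)).
  rewrite mulr_suml; apply: ler_sum => i _; rewrite -mulrBr.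
  by rewrite (le_trans (ler_norm _))// normrM ler_wpM2l// wt.
apply: (@le_trans _ _ ((v + e / (t + 1)) * t)); first by rewrite ler_wpM2r// ltW.
rewrite mulrDl lerD2l mulrAC ler_pdivrMr ?ltr_wpDl//.
by rewrite ler_wpM2l ?(ltW e0)// lerDl.
Qed.

End integral_probability_metric.

Lemma variation_norm_combination (R : realType) (T : Type) (F : set (T -> R)) h :
  (variation_norm F h < +oo)%E ->
  exists N w0 (w : 'I_N -> R) (f : 'I_N -> T -> R), combination F h w0 w f.
Proof.
by move=> /ereal_inf_lt[_ [N [w0 [w [f [c _]]]]] _]; exists N, w0, w, f.
Qed.

Lemma variation_norm_ge0 (R : realType) (T : Type) (F : set (T -> R)) h :
  (0 <= variation_norm F h)%E.
Proof.
apply: le_ereal_inf_tmp => _ [N [w0 [w [f [_ ->]]]]].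
by rewrite lee_fin sumr_ge0.
Qed.

(** * The high-probability event and the final bound *)

Lemma product_law_sample (R : realType) dO dX (Omega : measurableType dO)
    (X : measurableType dX) (P : probability Omega R) (mu : probability X R) m
    (x : 'I_m -> {mfun Omega >-> X}) : iid P mu x ->
  exists Q : probability (m.-tuple X) R, product_law mu Q /\
    forall E, Q E = P (sample x @^-1` E).
Proof.
move=> [law indep].
have ms : measurable_fun setT (sample x).
  apply/measurable_fun_tnthP => i.
  rewrite (_ : _ \o _ = x i)//; apply/funext => w.
  by rewrite /= tnth_mktuple.
pose s := MeasurableFun.Pack (MeasurableFun.Class
  (isMeasurableFun.Build _ _ _ _ _ ms)) : {mfun Omega >-> m.-tuple X}.
exists (distribution P s); split => // B mB.
transitivity (P [set w | forall i, B i (x i w)]).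
  congr (P _); apply/seteqP; split => w /= Bw i; have := Bw i;
    by rewrite tnth_mktuple.
by rewrite indep//; apply: eq_bigr => i _; exact: law.
Qed.

Lemma l2norm_ge0 (R : realType) p (t : 'rV[R]_p) : 0 <= l2norm t.
Proof. exact: sqrtr_ge0. Qed.

(* The level-(m+1) net already absorbs its discretisation error in the gap
   between the chaining constant 9 * sqrt 2 and 8 * sqrt (2 * pi). *)
Lemma discriminator_deviation (R : realType) d (X : measurableType d)
    (mu : probability X R) m (Q : probability (m.-tuple X) R) p
    (Theta : set 'rV[R]_p) (f : 'rV[R]_p -> X -> R) (L Delta delta : R) :
  (0 < m)%N -> product_law mu Q -> (0 < p)%N -> 0 < L -> 0 < Delta ->
  0 < delta < 1 -> (exists t, Theta t) ->
  (forall t, Theta t -> bounded_mfun (f t)) ->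
  (forall t, Theta t -> forall y, `|f t y| <= Delta) ->
  (forall t, Theta t -> forall i, -1 <= t ord0 i <= 1) ->
  (forall t t', Theta t -> Theta t' ->
    forall y, `|f t y - f t' y| <= L * l2norm (t - t')) ->
  exists E, [/\ measurable E, ((1 - delta)%:E <= Q E)%E &
    forall z t, E z -> Theta t ->
      2 * deviation mu (f t) z <= C_const p L Delta delta / Num.sqrt m%:R].
Proof.
move=> m0 hQ p0 L0 D0 /andP[d0 d1] [t0 Tt0] bf fD box lip.
pose s0 : {t | Theta t} := exist _ t0 Tt0.
pose h (s : {t | Theta t}) := f (sval s).
have bh s : bounded_mfun (h s) by exact: bf (svalP s).
have hD s y : `|h s y| <= Delta by exact: fD (svalP s) y.
have p0R : 0 < p%:R :> R by rewrite ltr0n.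
have m0R : 0 < m%:R :> R by rewrite ltr0n.
have sp0 : 0 < Num.sqrt p%:R :> R by rewrite sqrtr_gt0.
have sm0 : 0 < Num.sqrt m%:R :> R by rewrite sqrtr_gt0.
(* The Lipschitz constant times the radius of [box_net] at level 0. *)
pose sigma := 3 * L * Num.sqrt p%:R.
have sigma0 : 0 < sigma by rewrite !mulr_gt0.
have nets k : exists (I : finType) (q : I -> {t | Theta t})
    (pi : {t | Theta t} -> I), net h p sigma k q pi.
  have [I [q [pi [cardI close]]]] := box_net k s0 box.
  exists I, q, pi; split => // s y.
  apply: (le_trans (lip _ _ (svalP s) (svalP (q (pi s))) y)).
  apply: (le_trans (ler_wpM2l (ltW L0) (close s))).
  by rewrite le_eqVlt; apply/orP; left; apply/eqP; rewrite /sigma; ring.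
pose l := ln (1 / delta).
have l0 : 0 < l by rewrite ln_gt0// ltr_pdivlMr// mul1r.
(* Solves [m v^2 / (2 Delta^2) = ln (1 / delta)], which makes the failure probability [delta]. *)
pose v := Delta * Num.sqrt (2 * l) / Num.sqrt m%:R.
have v0 : 0 <= v by rewrite divr_ge0 ?mulr_ge0 ?sqrtr_ge0// ltW.
have [E [mE QE devE]] :=
  uniform_deviation m0 hQ p0 sigma0 bh nets s0 m.+1 hD D0 v0.
exists E; split => //.
  apply: le_trans QE; rewrite lee_fin lerD2l lerN2.
  have -> : m%:R * v ^+ 2 / (2 * Delta ^+ 2) = l.
    have -> : v ^+ 2 = Delta ^+ 2 * (2 * l) / m%:R.
      by rewrite /v expr_div_n exprMn !sqr_sqrtr// mulr_ge0// ltW.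
    by field; rewrite !lt0r_neq0.
  by rewrite expRN lnK ?posrE ?divr_gt0// div1r invrK.
move=> z t Ez Tt.
have dev : deviation mu (f t) z <= 6 * p%:R * sigma /
    Num.sqrt (2 * p%:R * m%:R) + v + 2 * (sigma / 2 ^+ m.+1).
  exact: (devE z (exist _ t Tt)).
set sp := Num.sqrt p%:R in sp0 sigma sigma0 nets devE dev.
set sm := Num.sqrt m%:R in sm0 v v0 QE devE dev *.
have spE : sp ^+ 2 = p%:R by rewrite sqr_sqrtr.
have smE : sm ^+ 2 = m%:R by rewrite sqr_sqrtr.
set s2 := Num.sqrt (2 : R).
have s2E : s2 ^+ 2 = 2 by rewrite sqr_sqrtr.
have s2_0 : 0 < s2 by rewrite sqrtr_gt0.
(* In units of [p L / sqrt m], chaining costs [18 / sqrt 2 <= 13] and the net error at most 3.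
   Doubled, this is 32, within [16 * sqrt (2 * pi)] since [pi >= 2]. *)
have s2_ge : 18 <= 13 * s2.
  rewrite -ler_sqr ?nnegrE ?mulr_ge0 ?(ltW s2_0)//.
  by rewrite exprMn s2E; lra.
have chainE : 6 * p%:R * sigma / Num.sqrt (2 * p%:R * m%:R) =
    18 * (p%:R * L / sm) / s2.
  rewrite !sqrtrM ?mulr_ge0// -/sp -/sm -/s2 /sigma.
  by field; rewrite !lt0r_neq0.
have net_err : 2 * (sigma / 2 ^+ m.+1) <= 3 * (p%:R * L / sm).
  have sp1 : sp <= p%:R.
    rewrite -spE expr2 ler_peMl ?(ltW sp0)//.
    by rewrite -sqrtr1 ler_wsqrtr// ler1n.
  have sm1 : sm <= 2 ^+ m.
    apply: (@le_trans _ _ m%:R).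
      rewrite -smE expr2 ler_peMl ?(ltW sm0)//.
      by rewrite -sqrtr1 ler_wsqrtr// ler1n.
    by rewrite -natrX ler_nat ltnW// ltn_expl.
  rewrite exprS invfM /sigma.
  rewrite (_ : 2 * _ = 3 * (sp * L / 2 ^+ m)); last first.
    by field; rewrite lt0r_neq0 ?exprn_gt0.
  rewrite ler_wpM2l// ler_pM ?mulr_ge0 ?invr_ge0 ?(ltW sp0) ?(ltW L0) ?exprn_ge0//.
    by rewrite ler_wpM2r// ltW.
  by rewrite lef_pV2 ?posrE ?exprn_gt0.
have s2pi : 2 <= Num.sqrt (2 * pi) :> R.
  rewrite -ler_sqr ?nnegrE ?sqrtr_ge0// sqr_sqrtr ?mulr_ge0 ?pi_ge0//.
  by have := pi_ge2 R; lra.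
have w0 : 0 < p%:R * L / sm by rewrite divr_gt0// mulr_gt0.
have chain_le : 18 * (p%:R * L / sm) / s2 <= 13 * (p%:R * L / sm).
  by rewrite ler_pdivrMr//; have := ler_wpM2r (ltW w0) s2_ge; lra.
have CE : C_const p L Delta delta / sm =
    16 * Num.sqrt (2 * pi) * (p%:R * L / sm) + 2 * v.
  by rewrite /C_const /v -/l; ring.
have := ler_wpM2r (ltW w0) s2pi.
rewrite CE; rewrite chainE in dev; lra.
Qed.

Theorem corollary2 (R : realType)
  (* sample space, reference measure, densities *)
  (dX : measure_display) (X : measurableType dX)
  (lambda : {sigma_finite_measure set X -> \bar R})
  (rho : probability X R -> X -> R)
  (* generators, discriminators, real distribution *)
  (G : set (probability X R)) (F : set (X -> R))
  (p : nat) (Theta : set 'rV[R]_p) (f : 'rV[R]_p -> X -> R) (L Delta : R)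
  (mu : probability X R)
  (* parametrized GAN model and its training *)
  (dA : measure_display) (A : measurableType dA)
  (kappa : {sigma_finite_measure set A -> \bar R})
  (g : A -> probability X R)
  (dO : measure_display) (Omega : measurableType dO) (P : probability Omega R)
  (m : nat) (x : 'I_m -> {mfun Omega >-> X}) (alpha : {mfun Omega >-> A})
  (tau_opt delta : R)
  (policy : attack_policy R X)
  (rhoP : forall nu, nu = mu \/ G nu ->
    is_density lambda nu (rho nu) /\ forall y, 0 < rho nu y)
  (F_meas : forall h, F h -> measurable_fun setT h)
  (A1 : forall nu1 nu2, G nu1 -> G nu2 ->
    disc_span F (log_ratio (rho nu1) (rho nu2)))
  (A2_even : forall h, F h -> F (fun y => - h y))
  (A2_bounded : forall h, F h -> (supnorm h <= Delta%:E)%E)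
  (A3_param : F = [set f t | t in Theta])
  (A3_box : forall t, Theta t -> forall i, -1 <= t ord0 i <= 1)
  (A3_lip : forall t t', Theta t -> Theta t' ->
    (supnorm (fun y => f t y - f t' y)%R <= (L * l2norm (t - t'))%:E)%E)
  (m_gt0 : (0 < m)%N)
  (delta01 : 0 < delta < 1)
  (gG : forall a, G (g a))
  (x_iid : iid P mu x)
  (rho_meas : measurable_fun setT (fun ay : A * X => rho (g ay.1) ay.2))
  (alphaP : gibbs_posterior P kappa (rho mu) (fun a => rho (g a)) x alpha)
  (tau_optP : {ae P, forall w,
    (ipm F (empirical R (sample x w)) (g (alpha w))
     - ereal_inf [set ipm F (empirical R (sample x w)) nu | nu in G]
     <= tau_opt%:E)%E})
  (Xi_fin : (Xi F G mu rho < +oo)%E)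
  (eps_le1 : eps_TV F G mu rho p m L Delta tau_opt delta <= 1) :
  let eps := eps_TV F G mu rho p m L Delta tau_opt delta in
  exists E : set (m.-tuple X),
    [/\ measurable E,
        ((1 - delta)%:E <= P (sample x @^-1` E))%E &
        {ae P, forall w, E (sample x w) ->
          (auc (g (alpha w)) mu (policy (g (alpha w)))
           <= (- (1 / 2) * eps ^+ 2 + eps + 1 / 2)%:E)%E}].
Proof.
move=> eps.
(* The generator at [w0] shows that [G] is nonempty, so [Xi] is not the supremum of the empty
   set. *)
have [w0 _] := probability_inhabited P.
have eps0 : 0 <= eps by rewrite divr_ge0 ?mulr_ge0 ?sqrtr_ge0.
have Xi_ub nu : G nu ->
    (variation_norm F (log_ratio (rho mu) (rho nu)) <= Xi F G mu rho)%E.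
  by move=> Gnu; apply: ereal_sup_ubound; exists nu.
have Xi_fin_num : Xi F G mu rho \is a fin_num.
  rewrite ge0_fin_numE//; apply: le_trans (Xi_ub _ (gG (alpha w0))).
  exact: variation_norm_ge0.
have Xi_ge0 : 0 <= fine (Xi F G mu rho).
  rewrite fine_ge0//; apply: le_trans (Xi_ub _ (gG (alpha w0))).
  exact: variation_norm_ge0.
have bF h : F h -> bounded_mfun h.
  by move=> Fh; exact: (@bounded_mfun_discriminator _ _ _ F Delta).
have comb nu : G nu -> exists N c (w : 'I_N -> R) (e : 'I_N -> X -> R),
    combination F (log_ratio (rho mu) (rho nu)) c w e.
  by move=> Gnu; apply: variation_norm_combination; rewrite (le_lt_trans (Xi_ub _ Gnu)).
(* A finite variation norm makes the log-ratio a finite combination of discriminators, hence bounded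
   and measurable. *)
have blog nu : G nu -> bounded_mfun (log_ratio (rho mu) (rho nu)).
  move=> /comb[N [c [w [e [Fe ->]]]]].
  apply: bounded_mfunD; first exact: bounded_mfun_cst.
  by apply: bounded_mfun_sum => i; apply: bounded_mfunZ; exact: bF.
have auc_jeffreys nu k : G nu ->
    \int[mu]_y log_ratio (rho mu) (rho nu) y -
    \int[nu]_y log_ratio (rho mu) (rho nu) y <= 4 * eps ^+ 2 ->
    (auc nu mu k <= (- (1 / 2) * eps ^+ 2 + eps + 1 / 2)%:E)%E.
  move=> Gnu S; apply: auc_le; first by rewrite eps0.
  move=> phi bphi phi01.
  have [d1 r1] := rhoP mu (or_introl erefl).
  have [d2 r2] := rhoP nu (or_intror Gnu).
  have := total_variation_le_jeffreys d1 d2 r1 r2 (blog _ Gnu) bphi phi01.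
  set D := _ - _ => /le_trans/(_ S); rewrite ler_pM2l// => De.
  rewrite leNgt; apply/negP => eD.
  by move: De; rewrite leNgt ltrXn2r// ltW// (le_lt_trans eps0).
(* If F contains no function but 0, then L may be negative and tau carries no
   information, but finiteness of Xi makes every log-ratio constant. *)
have [[h0 [y0 [Fh0 h0y0]]]|F0] := pselect (exists h y, F h /\ h y != 0); last first.
  exists setT; split => //.
    by rewrite probability_setT lee_fin gerBl; case/andP: delta01 => /ltW.
  apply: aeW => w _; apply: auc_jeffreys; first exact: gG.
  have [N [c [u [e [Fe ->]]]]] := comb _ (gG (alpha w)).
  have E0 y : c + \sum_(i < N) u i * e i y = c.
    rewrite big1 ?addr0// => i _.
    have [->|ne0] := eqVneq (e i y) 0; first by rewrite mulr0.
    by case: F0; exists (e i), y.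
  under eq_Rintegral do rewrite E0.
  under [X in _ - X]eq_Rintegral do rewrite E0.
  by rewrite !Rint_cst subrr mulr_ge0// sqr_ge0.
have Delta0 : 0 < Delta.
  by rewrite (lt_le_trans _ (supnorm_le (A2_bounded _ Fh0) y0))// normr_gt0.
(* By evenness [h0] and [- h0] both have parameters, and they differ at [y0]. The Lipschitz bound
   then forces these parameters apart and [L] to be positive; [p] is positive since distinct
   parameters need a coordinate. *)
have [t1 Tt1 ft1] : [set f t | t in Theta] h0 by rewrite -A3_param.
have [t2 Tt2 ft2] : [set f t | t in Theta] (fun y => - h0 y).
  by rewrite -A3_param; exact: A2_even.
have lip t t' : Theta t -> Theta t' ->
    forall y, `|f t y - f t' y| <= L * l2norm (t - t').
  by move=> Tt Tt'; exact: supnorm_le (A3_lip _ _ Tt Tt').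
have Ll0 : 0 < L * l2norm (t1 - t2).
  apply: lt_le_trans (lip _ _ Tt1 Tt2 y0).
  by rewrite ft1 ft2 opprK normr_gt0 -mulr2n mulrn_eq0.
have l0 : 0 < l2norm (t1 - t2).
  by rewrite lt_def l2norm_ge0 andbT; apply: contraTneq Ll0 => ->; rewrite mulr0 ltxx.
have L0 : 0 < L by rewrite -(pmulr_lgt0 _ l0).
have p0 : (0 < p)%N.
  rewrite lt0n; apply: contraTneq l0 => p0.
  rewrite /l2norm big1 ?sqrtr0 ?ltxx// => i.
  by have := ltn_ord i; rewrite {2}p0.
have FT t : Theta t -> F (f t) by rewrite A3_param; exists t.
have [Q [hQ QP]] := product_law_sample x_iid.
have [E [mE QE devE]] := discriminator_deviation m_gt0 hQ p0 L0 Delta0 delta01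
  (ex_intro _ t1 Tt1) (fun t Tt => bF _ (FT _ Tt))
  (fun t Tt => supnorm_le (A2_bounded _ (FT _ Tt))) A3_box lip.
exists E; split => //; first by rewrite -QP.
move: tau_optP; apply: filterS => w opt Ew.
apply: auc_jeffreys; first exact: gG.
have Fne : exists h, F h by exists h0.
(* [T] is half of [tau], so [eps^2 = Xi * 2 T / 8] and [Xi * T] is exactly [4 * eps^2]. *)
pose T := fine (ereal_inf [set ipm F mu nu | nu in G]) + tau_opt +
  C_const p L Delta delta / Num.sqrt m%:R.
have dT : (ipm F mu (g (alpha w)) <= T%:E)%E.
  have dev h : F h -> deviation mu h (sample x w) <=
      C_const p L Delta delta / Num.sqrt m%:R / 2.
    rewrite A3_param => -[t Tt <-].
    by rewrite ler_pdivlMr// mulrC devE.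
  have := ipm_generalization F_meas A2_even A2_bounded Fne (gG (alpha w)) dev opt.
  by rewrite mulrC divfK.
have T0 : 0 <= T.
  by rewrite -lee_fin (le_trans _ dT)// (ipm_ge0 F_meas A2_even A2_bounded Fne).
have hv : (variation_norm F (log_ratio (rho mu) (rho (g (alpha w)))) <=
    (fine (Xi F G mu rho))%:E)%E by rewrite fineK// Xi_ub.
apply: (le_trans (variation_norm_ipm F_meas A2_even A2_bounded Fne hv dT)).
rewrite /eps /eps_TV -/(tau _ _ _ _ _ _ _ _ _) /tau -/T.
rewrite expr_div_n exprMn !sqr_sqrtr ?mulr_ge0//.
by rewrite le_eqVlt; apply/orP; left; apply/eqP; field.
Qed.
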